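(* Let $\Omega$ be an infinite set, $K$ a field, and $V$ a $K$-vector space with basis $\Omega$. (i) The symmetric group $\mathrm{Sym}(\Omega)$ contains a coproduct of $2^{\mathrm{card}(\Omega)}$ copies of itself as a group. (ii) The monoid $\mathrm{Self}(\Omega)$ contains a coproduct of $2^{\mathrm{card}(\Omega)}$ copies of itself as a monoid. (iii) The $K$-algebra $\mathrm{End}_K(V)$ contains a coproduct of $2^{\mathrm{card}(\Omega)}$ copies of itself as an associative $K$-algebra.
   Context: $\mathrm{Sym}(\Omega)$ is the group of all permutations of $\Omega$; $\mathrm{Self}(\Omega)$ is the monoid of all maps $\Omega\to\Omega$ under composition; $\mathrm{End}_K(V)$ is the $K$-algebra of $K$-linear endomorphisms of $V$. Coproducts are taken in the category of all groups, of all monoids, and of all associative unital $K$-algebras, respectively. ''$A$ contains a coproduct of $\kappa$ copies of itself'' means that $A$ has a subalgebra (subgroup, submonoid, unital $K$-subalgebra) isomorphic to the coproduct of a $\kappa$-indexed family of copies of $A$. *)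

(* Defs.v *)
From HB Require Import structures.
From mathcomp Require Export all_boot all_algebra.
From mathcomp Require Export boolp classical_sets functions cardinality.

Set Implicit Arguments.
Unset Strict Implicit.
Unset Printing Implicit Defensive.

Import GRing.Theory.
Local Open Scope ring_scope.

Section Coproducts.

(* The three categories at hand are concrete.  Such a category is given here by
   a type of objects, the carrier of each object, and the predicate singling out
   the morphisms among the maps between carriers. *)
Variables (obj : Type) (carrier : obj -> Type).
Variable hom : forall A B : obj, (carrier A -> carrier B) -> Prop.

Definition is_coproduct (I : Type) (F : I -> obj) (C : obj)
    (inj : forall i, carrier (F i) -> carrier C) : Prop :=
  (forall i, hom (inj i)) /\
  forall (B : obj) (f : forall i, carrier (F i) -> carrier B),
    (forall i, hom (f i)) ->
    exists! g : carrier C -> carrier B,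
      hom g /\ forall i x, g (inj i x) = f i x.

(* [closed S] states that [S] is a subobject of its ambient object.  In each of
   the three categories the isomorphisms are the bijective morphisms. *)
Variable closed : forall A : obj, {pred carrier A} -> Prop.

Definition contains_iso_copy (A C : obj) : Prop :=
  exists S : {pred carrier A}, closed S /\
  exists phi : carrier C -> carrier A,
    [/\ hom phi, injective phi & forall y, y \in S <-> exists x, phi x = y].

Definition contains_coproduct_of_copies (I : Type) (A : obj) : Prop :=
  exists (C : obj) (inj : I -> carrier A -> carrier C),
    @is_coproduct I (fun=> A) C inj /\ contains_iso_copy A C.

End Coproducts.

Definition group_contains_coproduct (I : Type) (G : groupType) : Prop :=
  @contains_coproduct_of_copies groupType (fun G => G : Type)
    (fun G H f => {morph f : x y / (x * y)%g}) (fun G S => monoid.group_closed S) I G.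

Definition monoid_contains_coproduct (I : Type) (M : monoidType) : Prop :=
  @contains_coproduct_of_copies monoidType (fun M => M : Type)
    (fun M N f => monoid.monoid_morphism f) (fun M S => monoid.monoid_closed S) I M.

(* Unlike [algType K], this includes the zero algebra. *)
Record assocAlgebra (K : fieldType) := AssocAlgebra {
  alg_lmod :> lmodType K;
  alg_one : alg_lmod;
  alg_mul : alg_lmod -> alg_lmod -> alg_lmod;
  alg_mulA : associative alg_mul;
  alg_mul1 : left_id alg_one alg_mul;
  alg_mulr1 : right_id alg_one alg_mul;
  alg_mulDl : left_distributive alg_mul +%R;
  alg_mulDr : right_distributive alg_mul +%R;
  alg_scaleAl : forall (a : K) u v, a *: alg_mul u v = alg_mul (a *: u) v;
  alg_scaleAr : forall (a : K) u v, a *: alg_mul u v = alg_mul u (a *: v)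
}.

Definition is_alg_hom (K : fieldType) (A B : assocAlgebra K) (f : A -> B) :
    Prop :=
  [/\ linear f, f (alg_one A) = alg_one B &
      {morph f : x y / alg_mul x y >-> alg_mul x y}].

Definition is_subalgebra (K : fieldType) (A : assocAlgebra K) (S : {pred A}) :
    Prop :=
  [/\ GRing.submod_closed S, alg_one A \in S &
      {in S &, forall u v, alg_mul u v \in S}].

Definition algebra_contains_coproduct (K : fieldType) (I : Type)
    (A : assocAlgebra K) : Prop :=
  @contains_coproduct_of_copies (assocAlgebra K) (fun A => A : Type)
    (fun A B f => is_alg_hom f) (fun A S => is_subalgebra S) I A.

Section SelfMonoid.
Variable Omega : Type.

Definition Self : Type := Omega -> Omega.

HB.instance Definition _ := gen_eqMixin Self.
HB.instance Definition _ := gen_choiceMixin Self.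

Definition self_comp (f g : Self) : Self := f \o g.

Fact self_compA : associative self_comp. Proof. by []. Qed.
Fact self_comp1f : left_id (idfun : Self) self_comp. Proof. by []. Qed.
Fact self_compf1 : right_id (idfun : Self) self_comp. Proof. by []. Qed.

HB.instance Definition _ :=
  isMonoid.Build Self self_compA self_comp1f self_compf1.

End SelfMonoid.

Section SymGroup.
Variable Omega : Type.

Definition Sym : Type := {f : Omega -> Omega | bijective f}.

HB.instance Definition _ := gen_eqMixin Sym.
HB.instance Definition _ := gen_choiceMixin Sym.

Fact sym_inj (f g : Sym) : sval f =1 sval g -> f = g.
Proof.
case: f g => [f fb] [g gb] /= /funext fg; case: _ / fg gb => gb.
by congr exist; exact: Prop_irrelevance.
Qed.

Definition sym_one : Sym := exist _ idfun (inv_bij (fun=> erefl)).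

Definition sym_mul (f g : Sym) : Sym :=
  exist _ (sval f \o sval g) (bij_comp (svalP f) (svalP g)).

Fact sym_inv_ex (f : Sym) :
  exists g : Sym, cancel (sval f) (sval g) /\ cancel (sval g) (sval f).
Proof. by case: f => f [g fK gK] /=; exists (exist _ g (Bijective gK fK)). Qed.

Definition sym_inv (f : Sym) : Sym := projT1 (cid (sym_inv_ex f)).

Fact sym_mulA : associative sym_mul.
Proof. by move=> f g h; exact: sym_inj. Qed.
Fact sym_mul1f : left_id sym_one sym_mul.
Proof. by move=> f; exact: sym_inj. Qed.
Fact sym_mulf1 : right_id sym_one sym_mul.
Proof. by move=> f; exact: sym_inj. Qed.
Fact sym_mulVf : left_inverse sym_one sym_inv sym_mul.
Proof.
move=> f; apply: sym_inj => x /=.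
by rewrite /sym_inv; case: cid => g [/= fK _]; exact: fK.
Qed.
Fact sym_mulfV : right_inverse sym_one sym_inv sym_mul.
Proof.
move=> f; apply: sym_inj => x /=.
by rewrite /sym_inv; case: cid => g [/= _ gK]; exact: gK.
Qed.

HB.instance Definition _ :=
  isGroup.Build Sym sym_mulA sym_mul1f sym_mulf1 sym_mulVf sym_mulfV.

End SymGroup.

Section EndAlgebra.
Variables (K : fieldType) (V : lmodType K).

Definition Endo : Type := {linear V -> V}.

HB.instance Definition _ := gen_eqMixin Endo.
HB.instance Definition _ := gen_choiceMixin Endo.

Definition endo_fun (f : Endo) : V -> V := (f : {linear V -> V}).
Coercion endo_fun : Endo >-> Funclass.

Fact endo_inj (f g : Endo) : f =1 g -> f = g.
Proof.
case: f g => [f [[fD] [fZ]]] [g [[gD] [gZ]]] /funext/= fg.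
rewrite /endo_fun/= in fg; case: _ / fg gD gZ => gD gZ.
by rewrite (Prop_irrelevance gD fD) (Prop_irrelevance gZ fZ).
Qed.

Definition endo_zero : Endo := (\0 : V -> V) : {linear V -> V}.
Definition endo_opp (f : Endo) : Endo :=
  (\- (f : {linear V -> V})) : {linear V -> V}.
Definition endo_add (f g : Endo) : Endo :=
  ((f : {linear V -> V}) \+ (g : {linear V -> V})) : {linear V -> V}.
Definition endo_scale (a : K) (f : Endo) : Endo :=
  (a \*: (f : {linear V -> V})) : {linear V -> V}.
Definition endo_one : Endo := (@idfun V) : {linear V -> V}.
Definition endo_mul (f g : Endo) : Endo :=
  ((f : {linear V -> V}) \o (g : {linear V -> V})) : {linear V -> V}.

Fact endo_addA : associative endo_add.
Proof. by move=> f g h; apply: endo_inj => x; exact: addrA. Qed.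
Fact endo_addC : commutative endo_add.
Proof. by move=> f g; apply: endo_inj => x; exact: addrC. Qed.
Fact endo_add0 : left_id endo_zero endo_add.
Proof. by move=> f; apply: endo_inj => x; exact: add0r. Qed.
Fact endo_addN : left_inverse endo_zero endo_opp endo_add.
Proof. by move=> f; apply: endo_inj => x; exact: addNr. Qed.

HB.instance Definition _ :=
  GRing.isZmodule.Build Endo endo_addA endo_addC endo_add0 endo_addN.

Fact endo_mulA : associative endo_mul.
Proof. by move=> f g h; exact: endo_inj. Qed.
Fact endo_mul1f : left_id endo_one endo_mul.
Proof. by move=> f; exact: endo_inj. Qed.
Fact endo_mulf1 : right_id endo_one endo_mul.
Proof. by move=> f; exact: endo_inj. Qed.
Fact endo_mulDl : left_distributive endo_mul endo_add.
Proof. by move=> f g h; exact: endo_inj. Qed.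
Fact endo_mulDr : right_distributive endo_mul endo_add.
Proof. by move=> f g h; apply: endo_inj => x; exact: linearD. Qed.

Fact endo_scaleA a b (f : Endo) :
  endo_scale a (endo_scale b f) = endo_scale (a * b) f.
Proof. by apply: endo_inj => x; exact: scalerA. Qed.
Fact endo_scale1 : left_id 1 endo_scale.
Proof. by move=> f; apply: endo_inj => x; exact: scale1r. Qed.
Fact endo_scaleDr : right_distributive endo_scale +%R.
Proof. by move=> a f g; apply: endo_inj => x; exact: scalerDr. Qed.
Fact endo_scaleDl (f : Endo) : {morph endo_scale^~ f : a b / a + b}.
Proof. by move=> a b; apply: endo_inj => x; exact: scalerDl. Qed.

HB.instance Definition _ := GRing.Zmodule_isLmodule.Build K Endo
  endo_scaleA endo_scale1 endo_scaleDr endo_scaleDl.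

Fact endo_scaleAl a (f g : Endo) :
  endo_scale a (endo_mul f g) = endo_mul (endo_scale a f) g.
Proof. exact: endo_inj. Qed.
Fact endo_scaleAr a (f g : Endo) :
  endo_scale a (endo_mul f g) = endo_mul f (endo_scale a g).
Proof. by apply: endo_inj => x; rewrite /endo_fun/= linearZ. Qed.

Definition End_alg : assocAlgebra K :=
  @AssocAlgebra K Endo endo_one endo_mul endo_mulA endo_mul1f endo_mulf1
    endo_mulDl endo_mulDr endo_scaleAl endo_scaleAr.

End EndAlgebra.

(* The family [b] is a (possibly infinite) basis of [V]. *)
Definition is_basis (K : fieldType) (V : lmodType K) (Omega : Type)
    (b : Omega -> V) : Prop :=
  (forall (n : nat) (w : 'I_n -> Omega) (c : 'I_n -> K),
     injective w -> \sum_(i < n) c i *: b (w i) = 0 -> forall i, c i = 0) /\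
  (forall v : V, exists (n : nat) (w : 'I_n -> Omega) (c : 'I_n -> K),
     v = \sum_(i < n) c i *: b (w i)).

(* Main.v *)
From HB Require Import structures.
Require Import Defs.

(**
Write S for one of the three objects and I for the set of maps Omega -> bool.
For each i in I we let S act, through a copy rho_i, on a set (or on a vector
space with a basis) of size card Omega, so that the subobject generated by all
the rho_i(S) is their coproduct.  It suffices that each relation among words in
the rho_i(S) holds for all families of morphisms S -> B.

The set is a disjoint union of trees indexed by pairs of finite sequences D, P
in Omega.  The copy rho_i acts on the tree of (D, P) through the restriction of
i to D only, which is why card Omega many points are enough for 2^card Omega
copies: finitely many indices are separated by some finite D.  In each tree the
points are partitioned, for each restriction t, into copies of Omega on which S
acts naturally; each point belongs to one block for each t, its position in the
blocks of its children being prescribed by P according to its depth.  Starting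
from the root, an alternating word of length n reaches depth n only if each of
its letters moves the prescribed base point away, and the point that it then
reaches records the indices of the letters and the images of the base points.

For maps this determines a reduced word.  For endomorphisms, the coefficients at
points of depth n are products of off-diagonal matrix entries; conjugating by
transvections first makes their joint kernel on End(V) equal to the scalars, so
that the vanishing of these coefficients lets one rewrite a combination of words
of length n as a combination of shorter words.
*)

Set Implicit Arguments.
Unset Strict Implicit.
Unset Printing Implicit Defensive.

Import GRing.Theory.
Local Open Scope classical_set_scope.

(** * Cardinality *)

(** Zorn's lemma on the graphs of partial bijections between [A] and [B]: a maximal one exhausts [A]
    or [B], since otherwise one more pair could be added. *)
Lemma injective_on_total (T U : Type) (u0 : U) (t0 : T) (A : set T) (B : set U) :
  (exists f : T -> U, (forall x, A x -> B (f x)) /\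
     forall x y, A x -> A y -> f x = f y -> x = y) \/
  (exists f : U -> T, (forall x, B x -> A (f x)) /\
     forall x y, B x -> B y -> f x = f y -> x = y).
Proof.
pose P (G : set (T * U)) := (forall p, G p -> A p.1 /\ B p.2) /\
  forall p q, G p -> G q -> (p.1 = q.1 <-> p.2 = q.2).
have [F FP Ftot|G [[GAB Ginj] Gmax]] :=
  @Zorn_bigcup _ P.
  split=> [p [X FX Xp]|p q [X FX Xp] [Y FY Yq]].
    by have [h _] := FP _ FX; exact: h.
  have [XY|YX] := Ftot _ _ FX FY.
    by have [_ h] := FP _ FY; apply: h => //; exact: XY.
  by have [_ h] := FP _ FX; apply: h => //; exact: YX.
have [[x [Ax xG]]|allA] := pselect (exists x, A x /\ forall y, ~ G (x, y)); last first.
  left; have /choice [f fP] : forall x, exists y, A x -> G (x, y).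
    move=> x; have [Ax|nAx] := pselect (A x); last by exists u0.
    have [[y Gxy]|nG] := pselect (exists y, G (x, y)); first by exists y.
    by exfalso; apply: allA; exists x; split=> // y Gxy; apply: nG; exists y.
  exists f; split=> [x /fP /GAB[]//|x y /fP Gx /fP Gy].
  by have [_] := Ginj _ _ Gx Gy.
have [[y [By yG]]|allB] := pselect (exists y, B y /\ forall x, ~ G (x, y)); last first.
  right; have /choice [f fP] : forall y, exists x, B y -> G (x, y).
    move=> y; have [Ay|nAy] := pselect (B y); last by exists t0.
    have [[z Gxy]|nG] := pselect (exists x, G (x, y)); first by exists z.
    by exfalso; apply: allB; exists y; split=> // z Gxy; apply: nG; exists z.
  exists f; split=> [z /fP /GAB[]//|z z' /fP Gx /fP Gy].
  by have [h _] := Ginj _ _ Gx Gy; exact: h.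
exfalso; apply: (Gmax (G `|` [set (x, y)])).
  by split=> [p Gp|GG]; [left|apply: (xG y); apply: GG; right].
split=> [p [/GAB//|->//]|p q [Gp|->] [Gq|->]] //=; first exact: Ginj.
- by split=> e; exfalso; [apply: (xG p.2); rewrite -e|apply: (yG p.1); rewrite -e];
    rewrite -surjective_pairing.
- by split=> e; exfalso; [apply: (xG q.2); rewrite e|apply: (yG q.1); rewrite e];
    rewrite -surjective_pairing.
Qed.

Lemma infinite_nat_injection (T : Type) : infinite_set [set: T] ->
  exists nu : nat -> T, injective nu.
Proof.
move=> /infiniteP/card_leP/injfunPex[f _ f_inj].
exists (fun n => val (f (SigSub (mem_set (I : [set: nat] n))))) => m n.
by move=> /val_inj /f_inj; rewrite !inE => /(_ I I) -[].
Qed.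

Section Pairing.
Variable (T : Type).

Definition square_injection (A : set T) (g : T -> T -> T) : Prop :=
  (forall x y, A x -> A y -> A (g x y)) /\
  forall x y x' y', A x -> A y -> A x' -> A y' ->
    g x y = g x' y' -> x = x' /\ y = y'.

Definition square_graph (A : set T) (g : T -> T -> T) : set (T * T * T) :=
  [set p | [/\ A p.1.1, A p.1.2 & p.2 = g p.1.1 p.1.2]].

(* A maximal injection of A x A into A has card A = card T: otherwise a copy of
   A disjoint from A has room for the pairs of its union with A not in A x A. *)
Lemma pairing_injection : infinite_set [set: T] ->
  exists g : T -> T -> T, forall x y x' y', g x y = g x' y' -> x = x' /\ y = y'.
Proof.
move=> /infinite_nat_injection[nu nu_inj].
pose P (G : set (T * T * T)) := G = set0 \/
  exists A g, [/\ square_injection A g, G = square_graph A g &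
                  exists c, A c.1 /\ A c.2 /\ c.1 <> c.2].
have [F FP Ftot|G [[G0|[A [g [[gA gI] GE [[c0 c1] /= [Ac0 [Ac1 c01]]]]]]] Gmax]] :=
  @Zorn_bigcup _ P.
- have [[X [FX X0]]|nF] := pselect (exists X, F X /\ X <> set0); last first.
    left; apply/seteqP; split=> // p [X FX Xp]; apply: nF.
    by exists X; split=> // X0; rewrite X0 in Xp.
  right.
  have FP' Y p : F Y -> Y p -> exists A g, square_injection A g /\ Y = square_graph A g.
    by move=> /FP [->//|[A [g [Ag YE _]]]] _; exists A, g.
  (* The domain of the union is read off from its diagonal pairs [(x, x)]. *)
  pose A := [set x | exists2 Y, F Y & exists z, Y (x, x, z)].
  have FA2 x y : A x -> A y -> exists Y A' g',
      [/\ F Y, square_injection A' g', Y = square_graph A' g', A' x & A' y].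
    move=> [Y FY [z Yz]] [Y' FY' [z' Yz']].
    have [YY|YY] := Ftot _ _ FY FY'.
      have [A' [g' [sg E]]] := FP' _ _ FY' Yz'.
      exists Y', A', g'; split=> //; last by move: Yz'; rewrite E => -[].
      by move/YY : Yz; rewrite E => -[].
    have [A' [g' [sg E]]] := FP' _ _ FY Yz.
    exists Y, A', g'; split=> //; first by move: Yz; rewrite E => -[].
    by move/YY : Yz'; rewrite E => -[].
  have AP Y A' g' x : F Y -> Y = square_graph A' g' -> A' x -> A x.
    by move=> FY YE A'x; exists Y => //; exists (g' x x); rewrite YE.
  have /choice [g gP] : forall p : T * T, exists z, A p.1 -> A p.2 ->
      (\bigcup_(Y in F) Y) (p, z).
    move=> [x y]; have [[Ax Ay]|n] := pselect (A x /\ A y); last by exists x => ? ?; case: n.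
    have [Y [A' [g' [FY sg E A'x A'y]]]] := FA2 _ _ Ax Ay.
    by exists (g' x y) => _ _; exists Y => //; rewrite E.
  have cmp Y A1 g1 : F Y -> square_injection A1 g1 -> Y = square_graph A1 g1 ->
      forall x y, A1 x -> A1 y -> g (x, y) = g1 x y.
    move=> FY sg E x y xA yA.
    have [//| |Y' FY' Y'xy] := gP (x, y); try exact: (AP _ _ _ _ FY E).
    have [YY|YY] := Ftot _ _ FY FY'; last first.
      by move/YY : Y'xy; rewrite E => -[].
    have [A2 [g2 [sg2 E2]]] := FP' _ _ FY' Y'xy.
    move: Y'xy; rewrite E2 => -[/= _ _ ->].
    have : Y' (x, y, g1 x y) by apply: YY; rewrite E.
    by rewrite E2 => -[].
  have common4 x y x' y' : A x -> A y -> A x' -> A y' ->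
      exists Y A1 g1, [/\ F Y, square_injection A1 g1, Y = square_graph A1 g1 &
         [/\ A1 x, A1 y, A1 x' & A1 y']].
    move=> Ax Ay Ax' Ay'.
    have [Y1 [A1 [g1 [F1 s1 E1 Ax1 Ay1]]]] := FA2 _ _ Ax Ay.
    have [Y2 [A2 [g2 [F2 s2 E2 Ax2 Ay2]]]] := FA2 _ _ Ax' Ay'.
    have mono Y Y' B h B' h' z : Y = square_graph B h -> Y' = square_graph B' h' ->
        Y `<=` Y' -> B z -> B' z.
      move=> -> -> YY Bz; suff: square_graph B' h' (z, z, h z z) by case.
      exact: YY.
    have [YY|YY] := Ftot _ _ F1 F2.
      by exists Y2, A2, g2; split=> //; split=> //; exact: (mono _ _ _ _ _ _ _ E1 E2 YY).
    by exists Y1, A1, g1; split=> //; split=> //; exact: (mono _ _ _ _ _ _ _ E2 E1 YY).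
  exists A, (fun x y => g (x, y)); split.
  + split=> [x y Ax Ay|x y x' y' Ax Ay Ax' Ay'].
      have [Y [A1 [g1 [FY s1 E1 Ax1 Ay1]]]] := FA2 _ _ Ax Ay.
      rewrite (cmp _ _ _ FY s1 E1)//; apply: (AP _ _ _ _ FY E1).
      by case: s1 => s1 _; exact: s1.
    have [Y [A1 [g1 [FY s1 E1 [? ? ? ?]]]]] := common4 _ _ _ _ Ax Ay Ax' Ay'.
    by rewrite !(cmp _ _ _ FY s1 E1)//; case: s1 => _; exact.
  + apply/seteqP; split=> [[[x y] z] [Y FY Yxyz]|[[x y] z] [/= Ax Ay ->]]; last first.
      exact: gP.
    have [A1 [g1 [s1 E1]]] := FP' _ _ FY Yxyz.
    move: Yxyz; rewrite E1 => -[/= Ax Ay ->].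
    by split=> /=; rewrite ?(cmp _ _ _ FY s1 E1)//; exact: (AP _ _ _ _ FY E1).
  + have [//|[A1 [g1 [s1 E1 [c [c1 [c2 cc]]]]]]] := FP _ FX.
    by exists c; split; [|split=> //]; exact: (AP _ _ _ _ FX E1).
- exfalso.
  have [mu muK] : exists mu, cancel nu mu.
    have /choice [mu muP] : forall x, exists n, range nu x -> nu n = x.
      move=> x; have [[n _ <-]|n] := pselect (range nu x); first by exists n.
      by exists 0%N => /n.
    by exists mu => n; apply: nu_inj; apply: muP; exists n.
  (* The empty graph is not maximal: the pairing of natural numbers, carried over by [nu], extends
     it. *)
  apply: (Gmax (square_graph (range nu) (fun x y => nu (pickle (mu x, mu y))))).
    rewrite G0; split=> // h.
    suff : @set0 (T * T * T) (nu 0%N, nu 0%N, nu (pickle (mu (nu 0%N), mu (nu 0%N)))) by [].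
    by apply: h; split=> //=; exists 0%N.
  right; exists (range nu), (fun x y => nu (pickle (mu x, mu y))); split=> //.
    split=> [x y _ _|x y x' y' [n _ <-] [m _ <-] [n' _ <-] [m' _ <-]].
      by exists (pickle (mu x, mu y)).
    by rewrite !muK => /nu_inj/(pcan_inj pickleK)[-> ->].
  exists (nu 0%N, nu 1%N) => /=; split; first by exists 0%N.
  by split; [exists 1%N|move=> /nu_inj].
- have [[h [hB hI]]|[h [hA hI]]] := @injective_on_total T T c0 c0 A (~` A); last first.
    (* If the complement of [A] injects into [A], so does all of [T]: the tags [c0] and [c1] keep
       the points inside and outside [A] apart. *)
    pose e x := if `[< A x >] then g c0 x else g c1 (h x).
    have eA x : A (e x).
      by rewrite /e; case: asboolP => Ax; apply: gA => //; exact: hA.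
    have eI : injective e.
      move=> x y; rewrite /e; case: asboolP => Ax; case: asboolP => Ay /gI.
      - by case.
      - by case=> //; exact: hA.
      - by case=> //; [exact: hA|move=> /esym].
      - by case=> //; [exact: hA|exact: hA|move=> _; exact: hI].
    by exists (fun x y => g (e x) (e y)) => x y x' y' /gI[]// /eI -> /eI ->.
  exfalso.
  have /choice [k kP] : forall x, exists y, (h @` A) x -> A y /\ h y = x.
    by move=> x; have [[y Ay <-]|n] := pselect ((h @` A) x); [exists y|exists c0].
  pose A' := A `|` h @` A.
  have hAn x : (h @` A) x -> ~ A x by case=> y /hB + <-.
  pose r x := if `[< A x >] then x else k x.
  pose t x := if `[< A x >] then c0 else c1.
  have rA x : A' x -> A (r x).
    rewrite /r; case: asboolP => // Ax [//|]; by move=> /kP[].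
  have tA x : A (t x) by rewrite /t; case: asboolP.
  have tr x y : A' x -> A' y -> t x = t y -> r x = r y -> x = y.
    rewrite /t /r => A'x A'y; case: asboolP => Ax; case: asboolP => Ay //.
      by move=> /esym.
    case: A'x A'y => [//|hx] [//|hy] _ e.
    by have [_ <-] := kP _ hx; have [_ <-] := kP _ hy; rewrite e.
  (* A point of [A'] is determined by its tag [t] and its representative [r] in [A]. Pairs not in
     the square of [A] are coded in [A] and then moved out of [A] by [h], so they never collide with
     values of [g] on that square. *)
  pose code x y := g (g (t x) (t y)) (g (r x) (r y)).
  have codeA x y : A' x -> A' y -> A (code x y).
    by move=> /rA ? /rA ?; apply/gA; apply/gA => //; exact: tA.
  pose g' x y := if `[< A x /\ A y >] then g x y else h (code x y).
  apply: (Gmax (square_graph A' g')).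
    split=> [p|GG].
      rewrite GE => -[Ap1 Ap2 pE]; split; [by left|by left|].
      by rewrite /g'; case: asboolP => // -[].
    have hc : (h @` A) (h c0) by exists c0.
    suff : G (h c0, h c0, g' (h c0) (h c0)) by rewrite GE => -[/=] /(hAn _ hc).
    by apply: GG; split=> //=; right.
  right; exists A', g'; split=> //; last first.
    by exists (c0, c1); split; [left|split=> //; left].
  split=> [x y Ax Ay|x y x' y' Ax Ay Ax' Ay'].
    rewrite /g'; case: asboolP => [[? ?]|_]; first by left; exact: gA.
    by right; exists (code x y) => //; exact: codeA.
  rewrite /g'; case: asboolP => [[? ?]|_]; case: asboolP => [[? ?]|_].
  - exact: (gI).
  - by move=> e; exfalso; apply: (hB (code x' y')); [exact: codeA|rewrite -e; exact: gA].
  - by move=> e; exfalso; apply: (hB (code x y)); [exact: codeA|rewrite e; exact: gA].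
  - move=> /hI e; have /gI[] : code x y = code x' y' by apply: e; exact: codeA.
    + by apply: gA; exact: tA.
    + by apply: gA; exact: rA.
    + by apply: gA; exact: tA.
    + by apply: gA; exact: rA.
    + move=> /gI[]; try exact: tA.
      by move=> tx ty /gI[]; try exact: rA; move=> rx ry; split; exact: tr.
Qed.

End Pairing.

Lemma bijective_of_injective (T U : Type) (f : T -> U) (g : U -> T) :
  injective f -> injective g -> exists h : T -> U, bijective h.
Proof.
pose inT A (x : A) : [set: A] := SigSub (mem_set (I : [set: A] x)).
have le (A B : Type) (h : A -> B) : injective h -> ([set: A] #<= [set: B])%card.
  move=> h_inj; apply/card_leP/injfunPex; exists (fun x => inT _ (h (val x))) => //.
  by move=> x y _ _ [] /h_inj/val_inj.
move=> /le TU /le UT; have /card_bijP[h [k hK kK]] := Cantor_Bernstein TU UT.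
exists (fun x => val (h (inT _ x))); exists (fun y => val (k (inT _ y))) => x.
  by rewrite (_ : inT _ _ = h (inT _ x)) ?hK//; exact: val_inj.
by rewrite (_ : inT _ _ = k (inT _ x)) ?kK//; exact: val_inj.
Qed.

Section SequencesOver.
Variables (T : Type) (g : T -> T -> T) (nu : nat -> T).
Hypothesis g_inj : forall x y x' y', g x y = g x' y' -> x = x' /\ y = y'.
Hypothesis nu_inj : injective nu.

Lemma prod_injection (A B : Type) (f : A -> T) (h : B -> T) :
  injective f -> injective h -> exists k : A * B -> T, injective k.
Proof.
move=> f_inj h_inj; exists (fun p => g (f p.1) (h p.2)).
by move=> [a b] [a' b'] /= /g_inj[/f_inj -> /h_inj ->].
Qed.

(** The length is paired in because the end marker [nu 0] may itself be a value of [g]. *)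
Lemma seq_injection (A : Type) (f : A -> T) :
  injective f -> exists k : seq A -> T, injective k.
Proof.
move=> f_inj; pose c (s : seq A) := foldr (fun a => g (f a)) (nu 0) s.
exists (fun s => g (nu (size s)) (c s)) => s s' /g_inj[/nu_inj].
elim: s s' => [|a s IH] [|a' s'] //= [/IH e] /g_inj[/f_inj -> /e].
by move=> ->.
Qed.

End SequencesOver.

(** * The trees *)

(* A node (D, P, w) lies in the tree given by the data (D, P): the list D
   distinguishes finitely many indices i by the label [map i D], the list P
   prescribes base points, and w is the path from the root, last edge first. *)
Definition node (T : Type) : Type := seq T * seq T * seq (seq bool * T).

Lemma node_bijection (T : Type) : infinite_set [set: T] ->
  exists h : node T -> T, bijective h.
Proof.
move=> Tinf; have [g g_inj] := pairing_injection Tinf.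
have [nu nu_inj] := infinite_nat_injection Tinf.
have nub_inj : injective (fun b : bool => nu b) by case=> [] [] // /nu_inj.
have [k1 k1_inj] := seq_injection g_inj nu_inj (@inj_id T).
have [k2 k2_inj] := seq_injection g_inj nu_inj nub_inj.
have [k3 k3_inj] := prod_injection g_inj k2_inj (@inj_id T).
have [k4 k4_inj] := seq_injection g_inj nu_inj k3_inj.
have [k5 k5_inj] := prod_injection g_inj k1_inj k1_inj.
have [k k_inj] := prod_injection g_inj k5_inj k4_inj.
apply: (bijective_of_injective k_inj (g := fun x => ([:: x], [::], [::]))).
by move=> x y [].
Qed.

Section Words.
Variables (O : eqType) (o0 : O) (beta : nat -> O).
Implicit Types (t : seq bool) (w : seq (seq bool * O)) (q : O).

(* The words are partitioned, for each label t, into blocks in bijection with O: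
   the block with base w consists of w, at position [beta (size w)], and of its
   t-children (t, q) :: w, at the other positions q.  [isroot t w] means that w
   is the base of its t-block. *)
Fixpoint isroot t w : bool :=
  if w is l :: y then ~~ [&& l.1 == t, l.2 != beta (size y) & isroot t y]
  else true.

Definition word_base t w := if isroot t w then w else behead w.
Definition word_coord t w :=
  if isroot t w then beta (size w) else (head (t, o0) w).2.
Definition word_glue t w q := if q == beta (size w) then w else (t, q) :: w.

Lemma base_root t w : isroot t (word_base t w).
Proof.
rewrite /word_base; case: ifPn => //; case: w => //= l y.
by rewrite negbK => /and3P[].
Qed.

Lemma glueK t w : word_glue t (word_base t w) (word_coord t w) = w.
Proof.
rewrite /word_glue /word_base /word_coord; case: (boolP (isroot t w)) => [_|].
  by rewrite eqxx.
case: w => //= -[s q] y; rewrite negbK /= => /and3P[/eqP-> /negPf-> _].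
by [].
Qed.

Lemma isroot_glue t w q :
  isroot t w -> isroot t (word_glue t w q) = (q == beta (size w)).
Proof. by rewrite /word_glue; case: ifPn => //= qN wr; rewrite ?eqxx wr ?qN. Qed.

Lemma base_glue t w q : isroot t w -> word_base t (word_glue t w q) = w.
Proof.
move=> wr; rewrite /word_base isroot_glue// /word_glue; by case: eqP.
Qed.

Lemma coord_glue t w q : isroot t w -> word_coord t (word_glue t w q) = q.
Proof.
move=> wr; rewrite /word_coord isroot_glue// /word_glue; by case: eqP.
Qed.

Definition step (l : seq bool * (O -> O)) w :=
  word_glue l.1 (word_base l.1 w) (l.2 (word_coord l.1 w)).

Definition run (L : seq (seq bool * (O -> O))) w := foldr step w L.

Lemma size_base t w : size (word_base t w) <= size w.
Proof. by rewrite /word_base; case: ifP => //; rewrite size_behead leq_pred. Qed.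

Lemma size_glue t w q : size (word_glue t w q) <= (size w).+1.
Proof. by rewrite /word_glue; case: ifP. Qed.

Lemma size_run L : size (run L [::]) <= size L.
Proof.
elim: L => //= l L IH; rewrite {1}/step (leq_trans (size_glue _ _ _))// ltnS.
exact: leq_trans (size_base _ _) IH.
Qed.

(** Length is gained only at the base of a block: from any other word the base is one edge shorter,
    and gluing adds at most one edge. *)
Lemma step_max l w : size (step l w) = (size w).+1 ->
  step l w = (l.1, l.2 (beta (size w))) :: w.
Proof.
rewrite /step => e; have : size (word_base l.1 w) = size w.
  apply/eqP; rewrite eqn_leq size_base -ltnS -e; exact: size_glue.
move: e; rewrite /word_base /word_coord; case: ifPn => [wr|].
  by rewrite /word_glue; case: ifP => // _ /= /eqP; rewrite ltn_eqF.
by case: w => //= a w _ _ /eqP; rewrite ltn_eqF.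
Qed.

(** The word reached from the root if every letter adds an edge: the letter followed by [k] letters
    then acts at the base point [beta k]. *)
Fixpoint target (L : seq (seq bool * (O -> O))) : seq (seq bool * O) :=
  if L is l :: L' then (l.1, l.2 (beta (size L'))) :: target L' else [::].

Lemma size_target L : size (target L) = size L.
Proof. by elim: L => //= l L ->. Qed.

(** Each letter adds at most one edge, so full length is reached only if every letter adds one. *)
Lemma run_max L : size (run L [::]) = size L -> run L [::] = target L.
Proof.
elim: L => //= l L IH e.
have e' : size (run L [::]) = size L.
  apply/eqP; rewrite eqn_leq size_run -ltnS -e /step.
  apply: leq_trans (size_glue _ _ _) _; rewrite ltnS; exact: size_base.
by rewrite step_max ?e ?e'// IH.
Qed.

Fixpoint moves (L : seq (seq bool * (O -> O))) : bool :=
  if L is l :: L' then (l.2 (beta (size L')) != beta (size L')) && moves L'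
  else true.

(** The default label [rcons t true] is longer than [t], so that the hypothesis holds for empty [L],
    whose target is the root. *)
Lemma isroot_target t L : t != (head (rcons t true, id) L).1 ->
  isroot t (target L).
Proof. by case: L => //= l L /negPf; rewrite eq_sym => ->. Qed.

(** As consecutive labels differ, each letter meets a word that is the base of its block; it moves
    the base point there and so adds an edge. *)
Lemma run_moves L : moves L -> sorted (fun s t => s != t) (unzip1 L) ->
  run L [::] = target L.
Proof.
elim: L => //= l L IH /andP[lN mL] sL; rewrite (IH mL (path_sorted sL)).
have tr : isroot l.1 (target L).
  apply: isroot_target; case: L sL {IH mL lN} => [_|a L /= /andP[]//].
  by apply/eqP => /(congr1 size)/eqP; rewrite size_rcons ltn_eqF.
by rewrite /step /word_base /word_coord tr /word_glue size_target (negPf lN).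
Qed.

End Words.

(** * Action of each copy on the disjoint union of all trees *)

Section Tree.
Variables (O : eqType) (o0 : O).
Local Notation index := (O -> bool).
Implicit Types (i : index) (x : node O).

Definition node_base i x : node O :=
  (x.1, word_base (nth o0 x.1.2) (map i x.1.1) x.2).
Definition node_coord i x : O := word_coord o0 (nth o0 x.1.2) (map i x.1.1) x.2.
Definition node_glue i x (q : O) : node O :=
  (x.1, word_glue (nth o0 x.1.2) (map i x.1.1) x.2 q).
Definition node_isroot i x : bool :=
  isroot (nth o0 x.1.2) (map i x.1.1) x.2.

Lemma node_base_root i x : node_isroot i (node_base i x).
Proof. exact: base_root. Qed.

Lemma node_glueK i x : node_glue i (node_base i x) (node_coord i x) = x.
Proof. by case: x => d w; rewrite /node_glue /= glueK. Qed.

Lemma node_base_glue i x q :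
  node_isroot i x -> node_base i (node_glue i x q) = x.
Proof. by case: x => d w xr; rewrite /node_base /= base_glue. Qed.

Lemma node_coord_glue i x q :
  node_isroot i x -> node_coord i (node_glue i x q) = q.
Proof. by case: x => d w xr; rewrite /node_coord /= coord_glue. Qed.

Definition self_act i (g : O -> O) x : node O :=
  node_glue i (node_base i x) (g (node_coord i x)).

Lemma self_act1 i : self_act i id = id.
Proof. by apply/funext => x; rewrite /self_act node_glueK. Qed.

Lemma self_actM i g h : self_act i (g \o h) = self_act i g \o self_act i h.
Proof.
apply/funext => x; rewrite /self_act /=.
by rewrite node_base_glue ?node_coord_glue ?node_base_root.
Qed.

Definition word_act (L : seq (index * (O -> O))) x : node O :=
  foldr (fun l => self_act l.1 l.2) x L.

Lemma word_actE L D P w : word_act L (D, P, w) =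
  (D, P, run o0 (nth o0 P) [seq (map l.1 D, l.2) | l <- L] w).
Proof. by elim: L => //= l L ->. Qed.

(** For each pair of distinct members of [s], the list [D] receives one point at which they
    differ. *)
Lemma separating_seq (s : seq index) :
  exists D : seq O, {in s &, injective (fun i : index => map i D)}.
Proof.
have [D DP] : exists D : seq O, forall p, p \in [seq (i, j) | i <- s, j <- s] ->
    map p.1 D = map p.2 D -> p.1 = p.2.
  elim: [seq _ | _ <- _, _ <- _] => [|[i j] ps [D DP]]; first by exists [::].
  have [ij|] := pselect (i = j).
    by exists D => p; rewrite inE => /orP[/eqP->//|]; exact: DP.
  move=> /(contra_not (@funext _ _ i j))/existsNP[x ijx].
  exists (x :: D) => p; rewrite inE => /orP[/eqP-> /= [/ijx]//|/DP pP [_]].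
  exact: pP.
by exists D => i j si sj; apply: (DP (i, j)); exact: allpairs_f.
Qed.

End Tree.

(** * Reduced words in monoids and groups *)

Local Open Scope group_scope.

Section Submonoid.
Variables (N : monoidType) (S : {pred N}) (S_closed : monoid.monoid_closed S).
(** The [let] makes the type mention [S_closed], from which the monoid instance takes its closure
    proof. *)
Definition submonoid : Type := let _ := S_closed in {x : N | x \in S}.
HB.instance Definition _ := SubChoice.copy submonoid {x : N | x \in S}.
HB.instance Definition _ :=
  monoid.SubChoice_isSubMonoid.Build N S submonoid S_closed.
End Submonoid.

Section Subgroup.
Variables (N : groupType) (S : {pred N}) (S_closed : monoid.group_closed S).
Definition subgroup : Type := let _ := S_closed in {x : N | x \in S}.
HB.instance Definition _ := SubChoice.copy subgroup {x : N | x \in S}.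
HB.instance Definition _ :=
  monoid.SubChoice_isSubGroup.Build N S subgroup S_closed.
End Subgroup.

Section WordEvaluation.
Variables (I : eqType) (M : monoidType).
Implicit Types L : seq (I * M).

Definition eval (B : monoidType) (f : I -> M -> B) L : B :=
  foldr (fun l x => f l.1 l.2 * x) 1 L.

Definition reduced L : bool :=
  all (fun l => l.2 != 1) L && sorted (fun i j => i != j) (unzip1 L).

Lemma eval_cat (B : monoidType) (f : I -> M -> B) L L' :
  eval f (L ++ L') = eval f L * eval f L'.
Proof. by elim: L => [|l L IH] /=; rewrite ?mul1g// IH mulgA. Qed.

Lemma eval_morph (B B' : monoidType) (g : B -> B') (f : I -> M -> B) L :
  monoid.monoid_morphism g -> g (eval f L) = eval (fun i x => g (f i x)) L.
Proof. by case=> g1 gM; elim: L => //= l L <-. Qed.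

Lemma eq_eval (B : monoidType) (f g : I -> M -> B) L :
  (forall i x, f i x = g i x) -> eval f L = eval g L.
Proof. by move=> fg; elim: L => //= l L ->; rewrite fg. Qed.

(** Induction on the word: a trivial letter is dropped, a letter with the index of the next one is
    merged with it, and a trivial product removes both. The same [L'] serves all [B] and [f], hence
    both the copies and any test family. *)
Lemma exists_reduced L : exists L', reduced L' /\
  forall (B : monoidType) (f : I -> M -> B),
    (forall i, monoid.monoid_morphism (f i)) -> eval f L = eval f L'.
Proof.
elim: L => [|[i a] L [L' [redL' LE]]]; first by exists [::].
have [a1|aN1] := eqVneq a 1.
  exists L'; split=> // B f fh /=; rewrite LE// a1.
  by case: (fh i) => -> _; rewrite mul1g.
case: L' redL' LE => [|[j c] L'] redL' LE.
  exists [:: (i, a)]; split; first by rewrite /reduced /= aN1.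
  by move=> B f fh /=; rewrite LE.
have [ij|iNj] := eqVneq i j; last first.
  exists [:: (i, a), (j, c) & L']; split; last by move=> B f fh /=; rewrite LE.
  by move: redL'; rewrite /reduced /= aN1 iNj.
have [ac1|acN1] := eqVneq (a * c) 1.
  exists L'; split.
    by move: redL' => /andP[/= /andP[_ aL'] /path_sorted sL']; rewrite /reduced aL'.
  move=> B f fh /=; rewrite LE//= -ij mulgA; case: (fh i) => f1 fM.
  by rewrite -fM ac1 f1 mul1g.
exists ((j, a * c) :: L'); split.
  by move: redL'; rewrite /reduced /= acN1 => /andP[/andP[_ ->] ->].
move=> B f fh /=; rewrite LE//= -ij mulgA; case: (fh i) => f1 fM.
by rewrite -fM.
Qed.

Variables (N : monoidType) (rho : I -> M -> N).
Hypothesis rho_hom : forall i, monoid.monoid_morphism (rho i).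
Hypothesis rho_free : forall L L', reduced L -> reduced L' ->
  eval rho L = eval rho L' -> L = L'.

Definition generated : {pred N} := fun x => `[< exists L, x = eval rho L >].

Lemma generatedP x : reflect (exists L, x = eval rho L) (x \in generated).
Proof. exact: asboolP. Qed.

Lemma mem_generated i a : rho i a \in generated.
Proof. by apply/generatedP; exists [:: (i, a)]; rewrite /= mulg1. Qed.

Lemma generated_closed : monoid.monoid_closed generated.
Proof.
split; first by apply/generatedP; exists [::].
move=> x y /generatedP[L ->] /generatedP[L' ->]; apply/generatedP.
by exists (L ++ L'); rewrite eval_cat.
Qed.

(** Two words with the same value under [rho] have the same reduced form by [rho_free], hence the
    same value under [f]. Outside the generated submonoid the map takes the default value 1. *)
Lemma eval_extension (B : monoidType) (f : I -> M -> B) :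
  (forall i, monoid.monoid_morphism (f i)) ->
  exists g : N -> B, forall L, g (eval rho L) = eval f L.
Proof.
move=> fh; have /choice[g gP] : forall x, exists y,
    forall L, x = eval rho L -> y = eval f L.
  move=> x; have [[L ->]|n] := pselect (exists L, x = eval rho L); last first.
    by exists 1 => L xL; case: n; exists L.
  exists (eval f L) => L'.
  have [R [redR RE]] := exists_reduced L; have [R' [redR' RE']] := exists_reduced L'.
  by rewrite !(RE, RE')// => /(rho_free redR redR') ->.
by exists g => L; exact: gP.
Qed.

End WordEvaluation.

(** The submonoid generated by the copies is itself the coproduct, so no quotient of words has to be
    formed. Uniqueness holds because the copies generate it. *)
Lemma monoid_coproduct (I : eqType) (M N : monoidType) (rho : I -> M -> N) :
  (forall i, monoid.monoid_morphism (rho i)) ->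
  (forall L L', reduced L -> reduced L' -> eval rho L = eval rho L' -> L = L') ->
  exists (C : monoidType) (inj : I -> M -> C),
    is_coproduct (carrier := fun M : monoidType => M : Type)
      (fun M N f => monoid.monoid_morphism f) inj /\
    contains_iso_copy (carrier := fun M : monoidType => M : Type)
      (fun M N f => monoid.monoid_morphism f)
      (fun M S => monoid.monoid_closed S) N C.
Proof.
move=> rho_hom rho_free.
pose C : monoidType := submonoid (generated_closed rho).
pose inj i a : C := Sub (rho i a) (mem_generated rho i a).
have valE : monoid.monoid_morphism (val : C -> N) by [].
have inj_hom i : monoid.monoid_morphism (inj i).
  have [r1 rM] := rho_hom i.
  by split=> [|x y]; apply: val_inj; rewrite /= ?r1 ?rM.
have injE L : val (eval inj L) = eval rho L by rewrite (eval_morph _ _ valE).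
have surj c : exists L, c = eval inj L.
  have /generatedP[L cL] : val c \in generated rho by exact: valP.
  by exists L; apply: val_inj; rewrite injE.
exists C, inj; split.
  split=> // B f fh; have [g gP] := eval_extension rho_hom rho_free fh.
  have gE L : g (val (eval inj L)) = eval f L by rewrite injE.
  exists (g \o val); split; first split.
  - split=> [|x y]; first exact: (gE [::]).
    have [L ->] := surj x; have [L' ->] := surj y.
    by rewrite -eval_cat /= !gE eval_cat.
  - by move=> i x; have := gE [:: (i, x)]; rewrite /= !mulg1.
  - move=> h [h_hom hE]; apply/funext => x; have [L ->] := surj x.
    by rewrite /= gE (eval_morph _ _ h_hom); apply: eq_eval.
exists (generated rho); split; first exact: generated_closed.
exists val; split=> //.
move=> y; split=> [yS|[x <-]]; last exact: valP.
by exists (Sub y yS : C).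
Qed.

Lemma group_morphism_monoid (G H : groupType) (f : G -> H) :
  {morph f : x y / x * y} -> monoid.monoid_morphism f.
Proof. by move=> fM; split=> //; apply: (mulgI (f 1)); rewrite -fM !mulg1. Qed.

(** Letters are arbitrary elements of the group [M], so the inverse of a word is again a word: the
    generated submonoid is already a subgroup. *)
Lemma group_coproduct (I : eqType) (M N : groupType) (rho : I -> M -> N) :
  (forall i, {morph rho i : x y / x * y}) ->
  (forall L L', reduced L -> reduced L' -> eval rho L = eval rho L' -> L = L') ->
  exists (C : groupType) (inj : I -> M -> C),
    is_coproduct (carrier := fun G : groupType => G : Type)
      (fun G H f => {morph f : x y / x * y}) inj /\
    contains_iso_copy (carrier := fun G : groupType => G : Type)
      (fun G H f => {morph f : x y / x * y})
      (fun G S => monoid.group_closed S) N C.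
Proof.
move=> rho_hom rho_free.
have rho_mon i := group_morphism_monoid (rho_hom i).
have rhoV L : exists L', eval rho L' = (eval rho L)^-1.
  elim: L => [|[i a] L [L' LE]]; first by exists [::]; rewrite /= invg1.
  exists (L' ++ [:: (i, a^-1)]); rewrite eval_cat LE /= mulg1 invgM; congr (_ * _).
  by apply: (mulgI (rho i a)); rewrite -rho_hom !mulgV; case: (rho_mon i).
have closed : monoid.group_closed (generated rho).
  have [g1 gM] := generated_closed rho.
  split=> // x y xS /generatedP[L ->]; apply: gM => //.
  by have [L' <-] := rhoV L; apply/generatedP; exists L'.
pose C : groupType := subgroup closed.
pose inj i a : C := Sub (rho i a) (mem_generated rho i a).
have valE : monoid.monoid_morphism (val : C -> N) by [].
have inj_hom i : {morph inj i : x y / x * y}.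
  by move=> x y; apply: val_inj; rewrite /= rho_hom.
have injE L : val (eval inj L) = eval rho L by rewrite (eval_morph _ _ valE).
have surj c : exists L, c = eval inj L.
  have /generatedP[L cL] : val c \in generated rho by exact: valP.
  by exists L; apply: val_inj; rewrite injE.
exists C, inj; split.
  split=> // B f fh.
  have [g gP] := eval_extension rho_mon rho_free (fun i => group_morphism_monoid (fh i)).
  have gE L : g (val (eval inj L)) = eval f L by rewrite injE.
  exists (g \o val); split; first split.
  - move=> x y; have [L ->] := surj x; have [L' ->] := surj y.
    by rewrite -eval_cat /= !gE eval_cat.
  - by move=> i x; have := gE [:: (i, x)]; rewrite /= !mulg1.
  - move=> h [/group_morphism_monoid h_hom hE]; apply/funext => x.
    have [L ->] := surj x.
    by rewrite /= gE (eval_morph _ _ h_hom); apply: eq_eval.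
exists (generated rho); split=> //.
exists val; split=> //.
move=> y; split=> [yS|[x <-]]; last exact: valP.
by exists (Sub y yS : C).
Qed.

(** * Recovering a reduced word from its targets *)

Section TargetDetection.
Variables (O : eqType).
Implicit Types (beta : nat -> O) (L : seq (seq bool * (O -> O))).

Lemma eq_moves beta beta' L :
  (forall k, k < size L -> beta k = beta' k) -> moves beta L = moves beta' L.
Proof.
elim: L => //= l L IH bb; rewrite bb// IH// => k kL; apply: bb.
exact: leqW.
Qed.

Lemma eq_target beta beta' L :
  (forall k, k < size L -> beta k = beta' k) -> target beta L = target beta' L.
Proof.
elim: L => //= l L IH bb; rewrite bb// IH// => k kL; apply: bb.
exact: leqW.
Qed.

Definition upd beta n p k := if k == n then p else beta k.

Lemma upd_lt beta n p k : k < n -> upd beta n p k = beta k.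
Proof. by rewrite /upd => kn; rewrite ltn_eqF. Qed.

Lemma moves_upd beta L p : moves (upd beta (size L) p) L = moves beta L.
Proof. by apply: eq_moves => k; exact: upd_lt. Qed.

Lemma target_upd beta L p : target (upd beta (size L) p) L = target beta L.
Proof. by apply: eq_target => k; exact: upd_lt. Qed.

End TargetDetection.

Section Detection.
Variables (O : choiceType) (o0 : O).
Implicit Types (beta : nat -> O) (L : seq (seq bool * (O -> O))).

(* The target of L records the images of all base points that L moves; hence
   mutual detection determines each letter at every point that it moves. *)
Definition detects L L' :=
  forall beta, moves beta L -> target beta L = target beta L'.

Definition all_move L := foldr (fun l P => (exists p : O, l.2 p != p) /\ P) True L.

Lemma exists_moves L : all_move L -> exists beta, moves beta L.
Proof.
elim: L => [|l L IH] /=; first by exists (fun=> o0).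
move=> [[p lp] /IH[beta bL]]; exists (upd beta (size L) p).
by rewrite moves_upd bL /upd eqxx lp.
Qed.

Lemma detects_eq L L' : all_move L -> all_move L' ->
  detects L L' -> detects L' L -> L = L'.
Proof.
elim: L L' => [|[t l] L IH] [|[t' l'] L'] //= => [_ [_ mL']|[_ mL] _|].
- by move=> /(_ (fun=> o0) isT).
- by move=> _ /(_ (fun=> o0) isT).
move=> [[p lp] mL] [[p' lp'] mL'] LL' L'L.
have [b1 b1L] := exists_moves mL; have [b2 b2L] := exists_moves mL'.
(* The base point of the first letter can be set to any [q], because the remaining letters read only
   earlier base points. *)
have key (t1 t2 : seq bool) (f g : O -> O) L1 L2 b q :
    detects ((t1, f) :: L1) ((t2, g) :: L2) -> size L1 = size L2 ->
    moves b L1 -> f q != q -> [/\ t1 = t2, f q = g q & target b L1 = target b L2].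
  move=> D12 sz mb fq; have := D12 (upd b (size L1) q).
  rewrite /= moves_upd /upd eqxx -sz eqxx fq mb => /(_ isT)[-> ->].
  by rewrite -/(upd b _ _) target_upd sz target_upd.
have sz : size L = size L'.
  have := LL' (upd b1 (size L) p).
  rewrite /= moves_upd /upd eqxx lp b1L => /(_ isT)/(congr1 size).
  by rewrite /= !size_target => -[].
have [tt' _ _] := key _ _ _ _ _ _ _ _ LL' sz b1L lp.
(* At a point fixed by both letters they agree; any other point is moved by one of them, and
   detection from that side applies. *)
have ll' : l = l'.
  apply/funext => q; have [lq|lq] := eqVneq (l q) q; last first.
    by have [] := key _ _ _ _ _ _ _ _ LL' sz b1L lq.
  have [l'q|l'q] := eqVneq (l' q) q; first by rewrite lq.
  by have [] := key _ _ _ _ _ _ _ _ L'L (esym sz) b2L l'q.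
rewrite tt' ll'; congr cons; apply: IH => // b mb.
  by have [] := key _ _ _ _ _ _ _ _ LL' sz mb lp.
by have [] := key _ _ _ _ _ _ _ _ L'L (esym sz) mb lp'.
Qed.

End Detection.

Section Freeness.
Variables (O : choiceType) (o0 : O).
Local Notation index := (O -> bool).
Implicit Types L : seq (index * Self O).

Definition labelled (D : seq O) L : seq (seq bool * (O -> O)) :=
  [seq (map l.1 D, l.2 : O -> O) | l <- L].

Lemma reduced_all_move D L : reduced L -> all_move (labelled D L).
Proof.
move=> /andP[+ _]; elim: L => //= -[i g] L IH /= /andP[gN /IH]; split=> //.
apply/not_existsP => g1; move/eqP: gN; apply; apply/funext => p.
by apply/eqP; have /negP := g1 p; rewrite negbK.
Qed.

(** The list [P] tabulates [beta], so [L] carries the root of the tree of [(D, P)] to its target, at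
    depth [size L]. Since [L'] is no longer than [L] and reaches the same node, it too has full
    length there, and [run_max] identifies that node as its target. *)
Lemma word_act_detects D L L' : reduced L ->
  {in unzip1 L &, injective (fun i : index => map i D)} ->
  (forall x, word_act o0 L x = word_act o0 L' x) -> size L' <= size L ->
  detects (labelled D L) (labelled D L').
Proof.
move=> redL Dinj LL' sz beta mL.
pose P := mkseq beta (size L).
have bP n : n < size L -> nth o0 P n = beta n by move=> nL; rewrite nth_mkseq.
have sE K : size (labelled D K) = size K by rewrite size_map.
have run_eq : run o0 (nth o0 P) (labelled D L) [::] = run o0 (nth o0 P) (labelled D L') [::].
  by have := LL' (D, P, [::]); rewrite !word_actE => -[].
have sorted_lab : sorted (fun s t : seq bool => s != t) (unzip1 (labelled D L)).
  have -> : unzip1 (labelled D L) = [seq map i D | i <- unzip1 L].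
    by rewrite /unzip1 -!map_comp.
  case/andP: redL => _; case: (unzip1 L) Dinj => //= i s Dinj.
  apply: (homo_path_in (f := fun i : index => map i D)); last exact: allss.
  by move=> j k js ks; apply: contra_neq => /Dinj; exact.
have runL : run o0 (nth o0 P) (labelled D L) [::] = target beta (labelled D L).
  rewrite run_moves//; first by apply: eq_target => k; rewrite sE; exact: bP.
  by rewrite (eq_moves (beta' := beta))// => k; rewrite sE; exact: bP.
rewrite -runL run_eq run_max.
  apply: eq_target => k; rewrite sE => kL'; apply: bP; exact: leq_trans kL' sz.
apply/eqP; rewrite eqn_leq size_run -run_eq runL size_target !sE.
exact: sz.
Qed.

(** Detection by the longer word forces equal lengths, and then also holds in the other direction.
    As [D] separates all indices involved, the labelled words determine the original ones. *)
Lemma word_act_free L L' : reduced L -> reduced L' ->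
  (forall x, word_act o0 L x = word_act o0 L' x) -> L = L'.
Proof.
wlog sz : L L' / size L' <= size L.
  move=> W redL redL' LL'; have [sz|/ltnW sz] := leqP (size L') (size L).
    exact: W.
  by apply/esym; apply: W.
move=> redL redL' LL'; have [D Dinj] := separating_seq (unzip1 L ++ unzip1 L').
have DL : {in unzip1 L &, injective (fun i : index => map i D)}.
  by move=> i j iL jL; apply: Dinj; rewrite mem_cat ?iL ?jL.
have DL' : {in unzip1 L' &, injective (fun i : index => map i D)}.
  by move=> i j iL jL; apply: Dinj; rewrite mem_cat ?iL ?jL orbT.
have det := word_act_detects redL DL LL' sz.
have [beta mb] := exists_moves o0 (reduced_all_move D redL).
have sz' : size L = size L'.
  by have := det _ mb => /(congr1 size); rewrite !size_target !size_map.
have det' : detects (labelled D L') (labelled D L).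
  by apply: word_act_detects => //; rewrite sz'.
have {}E : labelled D L = labelled D L'.
  exact: detects_eq (reduced_all_move D redL) (reduced_all_move D redL') det det'.
move: Dinj.
elim: L L' {redL redL' LL' DL DL' sz det mb sz' det'} E =>
  [|[i g] L IH] [|[j h] L'] //= [ij gh E] Dinj.
have iS : i \in i :: unzip1 L ++ j :: unzip1 L' by rewrite inE eqxx.
have jS : j \in i :: unzip1 L ++ j :: unzip1 L' by rewrite inE mem_cat inE eqxx !orbT.
rewrite gh (Dinj _ _ iS jS ij) (IH _ E)// => k m kS mS; apply: Dinj.
  by move: kS; rewrite inE !mem_cat inE => /orP[|] ->; rewrite ?orbT.
by move: mS; rewrite inE !mem_cat inE => /orP[|] ->; rewrite ?orbT.
Qed.

End Freeness.

(** * Copies inside the monoid of self-maps and the symmetric group *)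

Section SelfSym.
Variables (O : choiceType) (o0 : O) (h : node O -> O) (k : O -> node O).
Hypotheses (hK : cancel h k) (kK : cancel k h).
Local Notation index := (O -> bool).

Definition self_copy (i : index) (g : Self O) : Self O :=
  h \o self_act o0 i g \o k.

Lemma self_copy_hom i : monoid.monoid_morphism (self_copy i).
Proof.
split=> [|f g].
  by apply/funext => x; rewrite /self_copy /= self_act1 /= kK.
apply/funext => x; rewrite -[RHS]/(self_copy i f (self_copy i g x)).
by rewrite /self_copy [f * g]/(f \o g) self_actM /= hK.
Qed.

Lemma eval_self_copy L x : eval self_copy L (h x) = h (word_act o0 L x).
Proof. 
elim: L x => //= l L IH x.
by rewrite -[LHS]/(self_copy l.1 l.2 (eval self_copy L (h x))) IH /self_copy /= hK. Qed.

Lemma self_copy_free L L' : reduced L -> reduced L' ->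
  eval self_copy L = eval self_copy L' -> L = L'.
Proof.
move=> redL redL' E; apply: (word_act_free (o0 := o0)) => // x.
by apply: (can_inj hK); rewrite -!eval_self_copy E.
Qed.

Lemma self_copy_bij i (f : Sym O) : bijective (self_copy i (sval f)).
Proof.
have [g [fK gK]] := sym_inv_ex f; have [r1 rM] := self_copy_hom i.
exists (self_copy i (sval g)) => x.
  rewrite -[LHS]/((self_copy i (sval g) * self_copy i (sval f)) x) -rM.
  by rewrite (_ : _ * _ = 1) ?r1//; apply/funext.
rewrite -[LHS]/((self_copy i (sval f) * self_copy i (sval g)) x) -rM.
by rewrite (_ : _ * _ = 1) ?r1//; apply/funext.
Qed.

Definition sym_copy i (f : Sym O) : Sym O := exist _ _ (self_copy_bij i f).

Lemma sym_copy_hom i : {morph sym_copy i : f g / f * g}.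
Proof.
move=> f g; apply: sym_inj => x /=; have [_ rM] := self_copy_hom i.
by rewrite [X in self_copy i X](_ : _ = (sval f : Self O) * sval g)// rM.
Qed.

Lemma sym_copy_free (L L' : seq (index * Sym O)) : reduced L -> reduced L' ->
  eval sym_copy L = eval sym_copy L' -> L = L'.
Proof.
pose sv (L : seq (index * Sym O)) : seq (index * Self O) :=
  [seq (l.1, sval l.2 : Self O) | l <- L].
have evalE K : eval self_copy (sv K) = sval (eval sym_copy K).
  by elim: K => //= l K ->.
have redE K : reduced K -> reduced (sv K).
  move=> /andP[K1 sK]; apply/andP; split; last by rewrite /unzip1 -map_comp.
  rewrite all_map; apply: sub_all K1 => l /=; apply: contra_neq => l1.
  by apply: sym_inj => x; rewrite l1.
move=> /redE redL /redE redL' /(congr1 sval); rewrite -!evalE.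
move=> /(self_copy_free redL redL'); apply: inj_map => -[i f] [j g] /= [-> fg].
by congr pair; apply: sym_inj => x; rewrite fg.
Qed.

End SelfSym.

Lemma sym_self_coproducts (Omega : Type) : infinite_set [set: Omega] ->
  group_contains_coproduct (Omega -> bool) (Sym Omega) /\
  monoid_contains_coproduct (Omega -> bool) (Self Omega).
Proof.
move=> Oinf; have [h [k hK kK]] := node_bijection Oinf.
have [o0 _] := infinite_setN0 Oinf.
split.
  exact: (group_coproduct (@sym_copy_hom {classic Omega} o0 h k hK kK)
    (@sym_copy_free {classic Omega} o0 h k hK kK)).
exact: (monoid_coproduct (@self_copy_hom {classic Omega} o0 h k hK kK)
  (@self_copy_free {classic Omega} o0 h k hK)).
Qed.

Local Close Scope group_scope.
Local Open Scope ring_scope.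

(** * Coproducts of associative algebras *)

Section AssocAlgebraTheory.
Variables (K : fieldType) (A : assocAlgebra K).

Lemma alg_mul0l (x : A) : alg_mul 0 x = 0.
Proof. by apply: (addrI (alg_mul 0 x)); rewrite -alg_mulDl !addr0. Qed.

Lemma alg_mul0r (x : A) : alg_mul x 0 = 0.
Proof. by apply: (addrI (alg_mul x 0)); rewrite -alg_mulDr !addr0. Qed.

Lemma alg_mul_sumr (T : Type) (s : seq T) (F : T -> A) x :
  alg_mul x (\sum_(t <- s) F t) = \sum_(t <- s) alg_mul x (F t).
Proof. exact: (big_morph _ (@alg_mulDr K A x) (alg_mul0r x)). Qed.

Lemma alg_mul_suml (T : Type) (s : seq T) (F : T -> A) x :
  alg_mul (\sum_(t <- s) F t) x = \sum_(t <- s) alg_mul (F t) x.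
Proof.
apply: (big_morph (fun y => alg_mul y x) _ (alg_mul0l x)) => u v.
exact: alg_mulDl.
Qed.

End AssocAlgebraTheory.

Section Homs.
Variables (K : fieldType) (A B : assocAlgebra K) (f : A -> B).
Hypothesis f_hom : is_alg_hom f.

Lemma alg_hom_linear : linear f. Proof. by case: f_hom. Qed.
Lemma alg_hom1 : f (alg_one A) = alg_one B. Proof. by case: f_hom. Qed.
Lemma alg_homM : {morph f : x y / alg_mul x y >-> alg_mul x y}.
Proof. by case: f_hom. Qed.
Lemma alg_homD : {morph f : x y / x + y}.
Proof. by move=> x y; rewrite -[x]scale1r alg_hom_linear !scale1r. Qed.
Lemma alg_hom0 : f 0 = 0.
Proof. by apply: (addrI (f 0)); rewrite -alg_homD !addr0. Qed.
Lemma alg_homZ a x : f (a *: x) = a *: f x.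
Proof. by rewrite -[a *: x]addr0 alg_hom_linear alg_hom0 addr0. Qed.
Lemma alg_hom_sum (T : Type) (s : seq T) (F : T -> A) :
  f (\sum_(t <- s) F t) = \sum_(t <- s) f (F t).
Proof. exact: (big_morph _ alg_homD alg_hom0). Qed.
End Homs.

Section ProductAlgebra.
Variables (K : fieldType) (A B : assocAlgebra K).
Let one : (A * B)%type := (alg_one A, alg_one B).
Let mul (x y : A * B) : (A * B)%type := (alg_mul x.1 y.1, alg_mul x.2 y.2).

Fact prod_mulA : associative mul.
Proof. by move=> x y z; rewrite /mul /= !alg_mulA. Qed.
Fact prod_mul1 : left_id one mul.
Proof. by move=> [x y]; rewrite /mul /= !alg_mul1. Qed.
Fact prod_mulr1 : right_id one mul.
Proof. by move=> [x y]; rewrite /mul /= !alg_mulr1. Qed.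
Fact prod_mulDl : left_distributive mul +%R.
Proof. by move=> x y z; rewrite /mul /= !alg_mulDl. Qed.
Fact prod_mulDr : right_distributive mul +%R.
Proof. by move=> x y z; rewrite /mul /= !alg_mulDr. Qed.
Fact prod_scaleAl (a : K) u v : a *: mul u v = mul (a *: u) v.
Proof. by rewrite /mul /= -!alg_scaleAl. Qed.
Fact prod_scaleAr (a : K) u v : a *: mul u v = mul u (a *: v).
Proof. by rewrite /mul /= -!alg_scaleAr. Qed.

Definition prod_alg : assocAlgebra K :=
  AssocAlgebra prod_mulA prod_mul1 prod_mulr1 prod_mulDl prod_mulDr
    prod_scaleAl prod_scaleAr.

End ProductAlgebra.

Section Subalgebra.
Variables (K : fieldType) (A : assocAlgebra K) (S : {pred A}).
Hypothesis S_closed : is_subalgebra S.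

Fact subalg_submod : GRing.submod_closed S. Proof. by case: S_closed. Qed.

Definition subalgebra : Type := let _ := S_closed in {x : A | x \in S}.
HB.instance Definition _ := SubChoice.copy subalgebra {x : A | x \in S}.
HB.instance Definition _ :=
  GRing.SubChoice_isSubLmodule.Build K A S subalgebra subalg_submod.

Let one : subalgebra := let: And3 _ S1 _ := S_closed in Sub (alg_one A) S1.
Let mul (x y : subalgebra) : subalgebra :=
  let: And3 _ _ SM := S_closed in
  Sub (alg_mul (val x) (val y)) (SM _ _ (valP x) (valP y)).

Let val_one : val one = alg_one A. Proof. by rewrite /one; case: S_closed. Qed.
Let val_mul x y : val (mul x y) = alg_mul (val x) (val y).
Proof. by rewrite /mul; case: S_closed. Qed.

Fact sub_mulA : associative mul.
Proof. by move=> x y z; apply: val_inj; rewrite !val_mul alg_mulA. Qed.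
Fact sub_mul1 : left_id one mul.
Proof. by move=> x; apply: val_inj; rewrite val_mul val_one alg_mul1. Qed.
Fact sub_mulr1 : right_id one mul.
Proof. by move=> x; apply: val_inj; rewrite val_mul val_one alg_mulr1. Qed.
Fact sub_mulDl : left_distributive mul +%R.
Proof.
by move=> x y z; apply: val_inj; rewrite val_mul !raddfD /= !val_mul alg_mulDl.
Qed.
Fact sub_mulDr : right_distributive mul +%R.
Proof.
by move=> x y z; apply: val_inj; rewrite val_mul !raddfD /= !val_mul alg_mulDr.
Qed.
Fact sub_scaleAl (a : K) u v : a *: mul u v = mul (a *: u) v.
Proof. by apply: val_inj; rewrite val_mul !linearZ /= val_mul alg_scaleAl. Qed.
Fact sub_scaleAr (a : K) u v : a *: mul u v = mul u (a *: v).
Proof. by apply: val_inj; rewrite val_mul !linearZ /= val_mul alg_scaleAr. Qed.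

Definition sub_alg : assocAlgebra K :=
  AssocAlgebra sub_mulA sub_mul1 sub_mulr1 sub_mulDl sub_mulDr
    sub_scaleAl sub_scaleAr.

Definition sub_alg_val : sub_alg -> A := fun x => val (x : subalgebra).

Lemma sub_alg_val_hom : is_alg_hom sub_alg_val.
Proof.
split=> [a x y|//|x y]; last exact: val_mul.
by rewrite /sub_alg_val linearP.
Qed.

Lemma sub_alg_val_inj : injective sub_alg_val.
Proof. exact: val_inj. Qed.

Lemma sub_alg_valP (x : sub_alg) : sub_alg_val x \in S.
Proof. exact: (valP (x : subalgebra)). Qed.

Definition sub_alg_Sub x (Sx : x \in S) : sub_alg := Sub x Sx : subalgebra.

Lemma sub_alg_SubK x (Sx : x \in S) : sub_alg_val (sub_alg_Sub Sx) = x.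
Proof. exact: SubK. Qed.

End Subalgebra.

Section WordCombinations.
Variables (K : fieldType) (I : Type) (A : assocAlgebra K).
Local Notation word := (seq (I * A)).

Definition weval (B : assocAlgebra K) (f : I -> A -> B) (L : word) : B :=
  foldr (fun l x => alg_mul (f l.1 l.2) x) (alg_one B) L.

Definition ceval (B : assocAlgebra K) (f : I -> A -> B) (s : seq (K * word)) : B :=
  \sum_(x <- s) x.1 *: weval f x.2.

Section Fixed.
Variables (B : assocAlgebra K) (f : I -> A -> B).

Lemma weval_cat L L' : weval f (L ++ L') = alg_mul (weval f L) (weval f L').
Proof. by elim: L => [|l L IH] /=; rewrite ?alg_mul1// IH alg_mulA. Qed.

Lemma weval_hom (B' : assocAlgebra K) (g : B -> B') L :
  is_alg_hom g -> g (weval f L) = weval (fun i x => g (f i x)) L.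
Proof.
by move=> gh; elim: L => /= [|l L <-]; [exact: alg_hom1|exact: alg_homM].
Qed.

Lemma ceval_hom (B' : assocAlgebra K) (g : B -> B') s :
  is_alg_hom g -> g (ceval f s) = ceval (fun i x => g (f i x)) s.
Proof.
move=> gh; rewrite alg_hom_sum//; apply: eq_bigr => x _.
by rewrite alg_homZ// weval_hom.
Qed.

Lemma eq_weval (g : I -> A -> B) L :
  (forall i x, f i x = g i x) -> weval f L = weval g L.
Proof. by move=> fg; elim: L => //= l L ->; rewrite fg. Qed.

Lemma eq_ceval (g : I -> A -> B) s :
  (forall i x, f i x = g i x) -> ceval f s = ceval g s.
Proof. by move=> fg; apply: eq_bigr => x _; rewrite (eq_weval _ fg). Qed.

Lemma ceval_cat s s' : ceval f (s ++ s') = ceval f s + ceval f s'.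
Proof. by rewrite /ceval big_cat. Qed.

Definition cscale (a : K) (s : seq (K * word)) : seq (K * word) :=
  [seq (a * x.1, x.2) | x <- s].

Lemma ceval_scale a s : ceval f (cscale a s) = a *: ceval f s.
Proof.
by rewrite /ceval big_map scaler_sumr; apply: eq_bigr => x _; rewrite scalerA.
Qed.

Definition cmul (s s' : seq (K * word)) : seq (K * word) :=
  [seq (x.1 * y.1, x.2 ++ y.2) | x <- s, y <- s'].

Lemma ceval_mul s s' : ceval f (cmul s s') = alg_mul (ceval f s) (ceval f s').
Proof.
rewrite /ceval big_allpairs_dep alg_mul_suml; apply: eq_bigr => x _.
rewrite alg_mul_sumr; apply: eq_bigr => y _ /=.
by rewrite weval_cat -alg_scaleAl -alg_scaleAr scalerA.
Qed.

Lemma ceval_letter i a : ceval f [:: (1, [:: (i, a)])] = f i a.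
Proof. by rewrite /ceval big_seq1 /= alg_mulr1 scale1r. Qed.

Lemma ceval_one : ceval f [:: (1, [::])] = alg_one B.
Proof. by rewrite /ceval big_seq1 /= scale1r. Qed.

End Fixed.
End WordCombinations.

(** The generated subalgebra is the coproduct as soon as every relation between the copies lifts
    along each [pi] through which they factor. Quantifying over [R] avoids building the free
    product. *)
Lemma algebra_coproduct (K : fieldType) (I : Type) (A N : assocAlgebra K)
    (rho : I -> A -> N) :
  (forall i, is_alg_hom (rho i)) ->
  (forall (R : assocAlgebra K) (h : I -> A -> R) (pi : R -> N) s,
    (forall i, is_alg_hom (h i)) -> is_alg_hom pi ->
    (forall i a, pi (h i a) = rho i a) ->
    pi (ceval h s) = 0 -> ceval h s = 0) ->
  exists (C : assocAlgebra K) (inj : I -> A -> C),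
    is_coproduct (carrier := fun A : assocAlgebra K => A : Type)
      (fun A B f => is_alg_hom f) inj /\
    contains_iso_copy (carrier := fun A : assocAlgebra K => A : Type)
      (fun A B f => is_alg_hom f) (fun A S => is_subalgebra S) N C.
Proof.
move=> rho_hom rho_free.
pose S : {pred N} := fun x => `[< exists s, x = ceval rho s >].
have SP x : reflect (exists s, x = ceval rho s) (x \in S) by exact: asboolP.
have Sc : is_subalgebra S.
  split; first split.
  - by apply/SP; exists [::]; rewrite /ceval big_nil.
  - move=> a x y /SP[s ->] /SP[s' ->]; apply/SP.
    by exists (cscale a s ++ s'); rewrite ceval_cat ceval_scale.
  - by apply/SP; exists [:: (1, [::])]; rewrite ceval_one.
  - by move=> x y /SP[s ->] /SP[s' ->]; apply/SP; exists (cmul s s'); rewrite ceval_mul.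
have Sr i a : rho i a \in S by apply/SP; exists [:: (1, [:: (i, a)])]; rewrite ceval_letter.
pose C := sub_alg Sc; pose inj i a : C := sub_alg_Sub Sc (Sr i a).
have vh : is_alg_hom (@sub_alg_val _ _ _ Sc) := sub_alg_val_hom Sc.
have inj_hom i : is_alg_hom (inj i).
  split=> [c x y||x y]; apply: (@sub_alg_val_inj _ _ _ Sc).
  - by rewrite (alg_hom_linear vh) !sub_alg_SubK (alg_hom_linear (rho_hom i)).
  - by rewrite (alg_hom1 vh) !sub_alg_SubK (alg_hom1 (rho_hom i)).
  - by rewrite (alg_homM vh) !sub_alg_SubK (alg_homM (rho_hom i)).
have injE s : sub_alg_val (ceval inj s) = ceval rho s.
  by rewrite (ceval_hom _ _ vh); apply: eq_ceval => i x; rewrite sub_alg_SubK.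
have surj c : exists s, c = ceval inj s.
  have /SP[s cs] := sub_alg_valP c.
  by exists s; apply: (@sub_alg_val_inj _ _ _ Sc); rewrite injE.
exists C, inj; split; last first.
  exists S; split=> //; exists (@sub_alg_val _ _ _ Sc); split=> //.
  move=> y; split=> [yS|[x <-]]; last exact: sub_alg_valP.
  by exists (sub_alg_Sub Sc yS); rewrite sub_alg_SubK.
split=> // B f fh.
have wd s s' : ceval rho s = ceval rho s' -> ceval f s = ceval f s'.
  (* Pairing the copies with the test family gives morphisms into [N * B] over [N]; a relation
     lifted there holds in [B] by the second projection. *)
  move=> ss'; pose R := prod_alg N B; pose h i a : R := (rho i a, f i a).
  have hh i : is_alg_hom (h i).
    split=> [c x y||x y]; congr pair.
    - exact: (alg_hom_linear (rho_hom i)).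
    - exact: (alg_hom_linear (fh i)).
    - exact: (alg_hom1 (rho_hom i)).
    - exact: (alg_hom1 (fh i)).
    - exact: (alg_homM (rho_hom i)).
    - exact: (alg_homM (fh i)).
  have fsth : is_alg_hom (fst : R -> N) by [].
  have sndh : is_alg_hom (snd : R -> B) by [].
  pose d := s ++ cscale (-1) s'.
  have d0 : ceval h d = 0.
    apply: (rho_free R h fst) => //.
    by rewrite (ceval_hom _ _ fsth) ceval_cat ceval_scale ss' scaleN1r subrr.
  have := congr1 snd d0; rewrite (ceval_hom _ _ sndh) ceval_cat ceval_scale.
  by rewrite scaleN1r => /eqP; rewrite subr_eq0 => /eqP.
have /choice[g gP] : forall c : C, exists y, forall s, c = ceval inj s -> y = ceval f s.
  move=> c; have [s ->] := surj c; exists (ceval f s) => s' ss'.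
  by apply: wd; rewrite -!injE ss'.
have gE s : g (ceval inj s) = ceval f s by exact: gP.
exists g; split; first split.
- split=> [c x y||x y].
  + have [s ->] := surj x; have [s' ->] := surj y.
    by rewrite -ceval_scale -ceval_cat !gE ceval_cat ceval_scale.
  + by rewrite -(ceval_one inj) gE ceval_one.
  + have [s ->] := surj x; have [s' ->] := surj y.
    by rewrite -ceval_mul !gE ceval_mul.
- by move=> i x; rewrite -(ceval_letter inj) gE ceval_letter.
- move=> g' [gh g'E]; apply/funext => x; have [s ->] := surj x.
  by rewrite gE (ceval_hom _ _ gh); apply: eq_ceval.
Qed.

(** A new vector in the span of [beta] and [e] only receives coordinates; any other joins [beta].
    With [e] the unit of an algebra, this splits off the scalar part of a letter. *)
Lemma basis_modulo (K : fieldType) (V : lmodType K) (e : V) (s : seq V) :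
  exists r (beta : 'I_r -> V) (c : V -> 'I_r -> K) (c0 : V -> K),
    (forall a, a \in s -> a = \sum_j c a j *: beta j + c0 a *: e) /\
    forall (d : 'I_r -> K) d0, \sum_j d j *: beta j = d0 *: e ->
      forall j, d j = 0.
Proof.
elim: s => [|a s [r [beta [c [c0 [cP indep]]]]]].
  by exists 0%N, (fun=> 0), (fun _ _ => 0), (fun=> 0); split=> // d d0 _ [].
have [[d [d0 aE]]|aN] :=
    pselect (exists d d0, a = \sum_j d j *: beta j + d0 *: e).
  exists r, beta, (fun x => if x == a then d else c x),
    (fun x => if x == a then d0 else c0 x); split=> // x.
  by rewrite inE; case: eqP => [-> _|_ /=]; [|exact: cP].
exists r.+1, (fun j => oapp beta a (unlift ord0 j)),
  (fun x j => if x == a then (j == ord0)%:R else oapp (c x) 0 (unlift ord0 j)),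
  (fun x => if x == a then 0 else c0 x); split=> [x|d d0].
  rewrite inE big_ord_recl unlift_none eqxx /=.
  case: eqP => [->|_ /= xs].
    rewrite scale1r scale0r addr0 big1 ?addr0// => j _.
    by rewrite scale0r.
  rewrite scale0r add0r; under eq_bigr do rewrite liftK /=.
  exact: cP.
rewrite big_ord_recl unlift_none /=; under eq_bigr do rewrite liftK /=.
have [d00|dN0] := eqVneq (d ord0) 0.
  rewrite d00 scale0r add0r => /indep dj j.
  by case: (unliftP ord0 j) => [k ->|->//]; exact: dj.
(* A nonzero coefficient [d ord0] would allow solving the relation for [a]. *)
move=> E; exfalso; apply: aN.
exists (fun j => - (d ord0)^-1 * d (lift ord0 j)), ((d ord0)^-1 * d0).
under eq_bigr do rewrite -scalerA; rewrite -scaler_sumr -scalerA -E.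
by rewrite scalerDr scalerA mulVf// scale1r scaleNr addrC addrK.
Qed.

(** * Lowering the word length when off-diagonal coefficients vanish *)

Section Elimination.
Variables (K : fieldType) (I O : eqType) (A R : assocAlgebra K).
Variable h : I -> A -> R.
Hypothesis h_hom : forall i, is_alg_hom (h i).
Variable psi : O -> O -> A -> K.
Hypothesis psi_linear : forall p q, linear (psi p q : A -> K^o).
Hypothesis psi1 : forall p q, p != q -> psi p q (alg_one A) = 0.
Hypothesis psi_ker : forall a, (forall p q, p != q -> psi p q a = 0) ->
  exists c, a = c *: alg_one A.

Definition shorter n (x : R) : Prop :=
  exists s : seq (K * seq (I * A)),
    (forall y, y \in s -> size y.2 < n)%N /\ x = ceval h s.

Lemma shorter0 n : shorter n 0.
Proof. by exists [::]; rewrite /ceval big_nil. Qed.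

Lemma shorterD n x y : shorter n x -> shorter n y -> shorter n (x + y).
Proof.
move=> [s [sn ->]] [s' [sn' ->]]; exists (s ++ s'); rewrite ceval_cat.
by split=> // y'; rewrite mem_cat => /orP[/sn|/sn'].
Qed.

Lemma shorter_sum n (T : eqType) (s : seq T) (F : T -> R) :
  (forall t, t \in s -> shorter n (F t)) -> shorter n (\sum_(t <- s) F t).
Proof.
move=> sn; rewrite big_seq; elim/big_ind: _ => //; first exact: shorter0.
exact: shorterD.
Qed.

Lemma shorter_word n c L : (size L < n)%N -> shorter n (c *: weval h L).
Proof.
move=> Ln; exists [:: (c, L)]; rewrite /ceval big_seq1; split=> // y.
by rewrite inE => /eqP ->.
Qed.

Lemma shorterM n i a x : shorter n x -> shorter n.+1 (alg_mul (h i a) x).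
Proof.
move=> [s [sn ->]]; exists (cmul [:: (1, [:: (i, a)])] s).
rewrite ceval_mul ceval_letter; split=> // y.
by rewrite /cmul /= cats0 => /mapP[z /sn zn ->].
Qed.

Lemma shorter_lt0 x : shorter 0 x -> x = 0.
Proof.
move=> [[|y s] [sn ->]]; first by rewrite /ceval big_nil.
by have := sn y (mem_head _ _).
Qed.

(* The letter followed by k letters is evaluated at the matrix entry given by
   p k and q k. *)
Fixpoint coef_word (p q : nat -> O) (l : seq A) : K :=
  if l is a :: l' then psi (p (size l')) (q (size l')) a * coef_word p q l'
  else 1.

Lemma eq_coef_word p q p' q' l :
  (forall k, k < size l -> p k = p' k)%N -> (forall k, k < size l -> q k = q' k)%N ->
  coef_word p q l = coef_word p' q' l.
Proof.
elim: l => //= a l IH pp qq; rewrite pp// qq// IH// => k kl.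
- by apply: pp; exact: leqW.
- by apply: qq; exact: leqW.
Qed.

Let psi_lin p q : {linear A -> K^o} :=
  HB.pack (psi p q) (GRing.isLinear.Build K A K^o _ _ (psi_linear p q)).

Lemma psi_sum p q (T : Type) (s : seq T) (F : T -> A) :
  psi p q (\sum_(t <- s) F t) = \sum_(t <- s) psi p q (F t).
Proof. exact: (linear_sum (psi_lin p q)). Qed.

Lemma psiZ p q c a : psi p q (c *: a) = c * psi p q a.
Proof. by rewrite -[psi p q _]/(psi_lin p q (c *: a)) linearZ. Qed.

Lemma psiD p q a b : psi p q (a + b) = psi p q a + psi p q b.
Proof. by rewrite -[a]scale1r psi_linear !scale1r. Qed.

(* In terms of tensors: as the functionals psi p q have joint kernel K.1, a tensor
   killed by all their products is a sum of pure tensors with a factor 1. *)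
Lemma elimination (tau : seq I) (s : seq (K * seq A)) :
  (forall x, x \in s -> size x.2 = size tau) ->
  (forall p q, (forall k, p k != q k) -> \sum_(x <- s) x.1 * coef_word p q x.2 = 0) ->
  (exists p q : O, p != q) ->
  shorter (size tau) (\sum_(x <- s) x.1 *: weval h (zip tau x.2)).
Proof.
move=> + + [p0 [q0 pq0]].
elim: tau s => [|i tau IH] s ssz s0.
  (* On empty words every product of coefficients is 1, and the distinct points [p0], [q0] give an
     admissible instance of the hypothesis. *)
  have := s0 (fun=> p0) (fun=> q0) (fun=> pq0).
  rewrite (eq_big_seq (fun x => x.1)) => [s0'|x /ssz /size0nil ->]; last first.
    by rewrite mulr1.
  have -> : \sum_(x <- s) x.1 *: weval h (zip [::] x.2) =
      (\sum_(x <- s) x.1) *: alg_one R.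
    by rewrite scaler_suml; apply: eq_bigr => x _; case: x.2.
  by rewrite s0' scale0r; exact: shorter0.
pose hd (x : K * seq A) := head 0 x.2.
have sE x : x \in s -> x.2 = hd x :: behead x.2.
  by move=> /ssz; rewrite /hd; case: x.2.
have [r [beta [c [c0 [cP indep]]]]] := basis_modulo (alg_one A) [seq hd x | x <- s].
have cP' x : x \in s -> hd x = \sum_j c (hd x) j *: beta j + c0 (hd x) *: alg_one A.
  by move=> xs; apply: cP; exact: map_f.
have szb x : x \in s -> size (behead x.2) = size tau.
  by move=> /[dup]/ssz + /sE e; rewrite e => -[].
(* [W j] collects the tails, weighted by the coefficient of [beta j] in the head letter. The scalar
   part of a head letter disappears, leaving a shorter word. *)
pose W j := \sum_(x <- s) (x.1 * c (hd x) j) *: weval h (zip tau (behead x.2)).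
have WE : \sum_(x <- s) x.1 *: weval h (zip (i :: tau) x.2) =
    \sum_j alg_mul (h i (beta j)) (W j) +
    \sum_(x <- s) (x.1 * c0 (hd x)) *: weval h (zip tau (behead x.2)).
  have -> : \sum_j alg_mul (h i (beta j)) (W j) = \sum_(x <- s) \sum_j
      alg_mul (h i (beta j)) ((x.1 * c (hd x) j) *: weval h (zip tau (behead x.2))).
    by rewrite exchange_big /=; apply: eq_bigr => j _; exact: alg_mul_sumr.
  rewrite -big_split /=; apply: eq_big_seq => x xs; rewrite {1}(sE _ xs) /=.
  rewrite {1}(cP' _ xs) (alg_homD (h_hom i)) (alg_hom_sum (h_hom i)).
  rewrite alg_mulDl scalerDr (alg_homZ (h_hom i)) (alg_hom1 (h_hom i)).
  rewrite -alg_scaleAl alg_mul1 scalerA alg_mul_suml scaler_sumr; congr (_ + _).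
  apply: eq_bigr => j _.
  by rewrite (alg_homZ (h_hom i)) -alg_scaleAl scalerA -alg_scaleAr.
rewrite WE; apply: shorterD; last first.
  apply: shorter_sum => x xs; apply: shorter_word.
  by rewrite size_zip szb// minnn.
apply: shorter_sum => j _; apply: shorterM.
pose sj := [seq (x.1 * c (hd x) j, behead x.2) | x <- s].
have -> : W j = \sum_(x <- sj) x.1 *: weval h (zip tau x.2) by rewrite big_map.
apply: IH => [_ /mapP[x xs ->]|p q pq]; first exact: szb.
rewrite big_map /=.
pose d j := \sum_(x <- s) x.1 * c (hd x) j * coef_word p q (behead x.2).
suff [d0 dE] : exists d0, \sum_j d j *: beta j = d0 *: alg_one A by exact: indep dE j.
apply: psi_ker => p1 q1 pq1; pose n := size tau.
(* Extending [p] and [q] by [p1] and [q1] at depth [n] turns the functional [psi p1 q1] on the sum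
   into the vanishing hypothesis for whole words; [psi1] removes the scalar parts. *)
pose p' k := if k == n then p1 else p k; pose q' k := if k == n then q1 else q k.
have pq' k : p' k != q' k by rewrite /p' /q'; case: ifP.
rewrite -[RHS](s0 p' q' pq') psi_sum.
under eq_bigr do rewrite psiZ mulr_suml.
rewrite exchange_big /=; apply: eq_big_seq => x xs.
have p'n : p' n = p1 by rewrite /p' eqxx.
have q'n : q' n = q1 by rewrite /q' eqxx.
rewrite [in RHS](sE _ xs) /= szb// -/n p'n q'n.
rewrite (eq_coef_word (p' := p) (q' := q)); last 2 first.
- by move=> k; rewrite szb// /p' => kn; rewrite ltn_eqF.
- by move=> k; rewrite szb// /q' => kn; rewrite ltn_eqF.
rewrite [in RHS](cP' _ xs) psiD psiZ psi1// mulr0 addr0 psi_sum mulrA mulr_sumr mulr_suml.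
by apply: eq_bigr => k _; rewrite psiZ !mulrA; rewrite mulrAC.
Qed.

End Elimination.

(** * Endomorphism algebras *)

(** Spanning in [is_basis] allows repeated basis vectors, whereas independence concerns injective
    families. The merged coefficients serve every [F] at once. *)
Lemma collect_terms (K : fieldType) (X : eqType) n (w : 'I_n -> X) (c : 'I_n -> K) :
  exists m (w' : 'I_m -> X) (c' : 'I_m -> K), injective w' /\
    forall (U : lmodType K) (F : X -> U),
      \sum_i c i *: F (w i) = \sum_j c' j *: F (w' j).
Proof.
pose s := undup [seq w i | i <- enum 'I_n].
pose w' j := tnth (in_tuple s) j.
have w'_inj : injective w' by apply/tuple_uniqP; exact: undup_uniq.
exists (size s), w', (fun j => \sum_(i | w i == w' j) c i); split=> // U F.
under [RHS]eq_bigr do rewrite scaler_suml.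
rewrite (exchange_big_dep predT)//=; apply: eq_bigr => i _.
have /tnthP[j0 wi] : w i \in in_tuple s by rewrite mem_undup map_f ?mem_enum.
rewrite (big_pred1 j0) => [|j]; first by rewrite wi.
by rewrite wi (inj_eq w'_inj) eq_sym.
Qed.

Section Basis.
Variables (K : fieldType) (V : lmodType K) (X : choiceType) (b : X -> V).
Hypothesis b_basis : is_basis b.

Lemma basis_expansion v : exists m (w : 'I_m -> X) (c : 'I_m -> K),
  injective w /\ v = \sum_j c j *: b (w j).
Proof.
have [n [w [c ->]]] := b_basis.2 v; have [m [w' [c' [w'_inj E]]]] := collect_terms w c.
by exists m, w', c'; split.
Qed.

(** The relation [P] is the graph of the extension: it is closed under linear combinations, and
    independence makes it single-valued at 0, hence everywhere. *)
Lemma basis_extension_ex (U : lmodType K) (h : X -> U) :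
  exists f : {linear V -> U}, forall x, f (b x) = h x.
Proof.
have rel n (w : 'I_n -> X) (c : 'I_n -> K) :
    \sum_i c i *: b (w i) = 0 -> \sum_i c i *: h (w i) = 0.
  have [m [w' [c' [w'_inj E]]]] := collect_terms w c.
  rewrite !E => /(b_basis.1 _ _ _ w'_inj) c0.
  by rewrite big1// => j _; rewrite c0 scale0r.
pose P v u := exists n (w : 'I_n -> X) (c : 'I_n -> K),
  v = \sum_i c i *: b (w i) /\ u = \sum_i c i *: h (w i).
have comb a v u v' u' : P v u -> P v' u' -> P (a *: v + v') (a *: u + u').
  move=> [n [w [c [-> ->]]]] [n' [w' [c' [-> ->]]]].
  exists (n + n')%N, (fun k => match fintype.split k with inl i => w i | inr j => w' j end),
    (fun k => match fintype.split k with inl i => a * c i | inr j => c' j end).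
  split; rewrite big_split_ord scaler_sumr; congr (_ + _); apply: eq_bigr => i _ /=.
  - by rewrite scalerA (unsplitK (inl _ i)).
  - by rewrite (unsplitK (inr _ i)).
  - by rewrite scalerA (unsplitK (inl _ i)).
  - by rewrite (unsplitK (inr _ i)).
have P0 u : P 0 u -> u = 0 by move=> [n [w [c [/esym/rel + ->]]]].
have /choice[f fP] : forall v, exists u, P v u.
  by move=> v; have [n [w [c ->]]] := b_basis.2 v; exists (\sum_i c i *: h (w i)), n, w, c.
have f_uniq v u : P v u -> f v = u.
  move=> Pvu; have := comb (-1) _ _ _ _ Pvu (fP v).
  by rewrite !scaleN1r addNr => /P0/eqP; rewrite addrC subr_eq0 => /eqP.
have f_lin : linear f by move=> a u v; apply: f_uniq; apply: comb.
pose F : {linear V -> U} := HB.pack f (GRing.isLinear.Build K V U _ f f_lin).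
exists F => x /=.
apply: f_uniq; exists 1%N, (fun=> x), (fun=> 1).
by rewrite !big_ord1 !scale1r.
Qed.

Definition basis_ext (U : lmodType K) (h : X -> U) : {linear V -> U} :=
  projT1 (cid (basis_extension_ex h)).

Lemma basis_extE (U : lmodType K) (h : X -> U) x : basis_ext h (b x) = h x.
Proof. exact: (projT2 (cid (basis_extension_ex h))). Qed.

Lemma basis_eq (U : lmodType K) (f g : {linear V -> U}) :
  (forall x, f (b x) = g (b x)) -> f =1 g.
Proof.
move=> fg v; have [m [w [c [_ ->]]]] := basis_expansion v.
by rewrite !linear_sum; apply: eq_bigr => j _; rewrite !linearZ fg.
Qed.

Definition coef (x : X) : {linear V -> K^o} :=
  basis_ext (fun y => (x == y)%:R : K^o).

Lemma coef_basis x y : coef x (b y) = (x == y)%:R.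
Proof. exact: basis_extE. Qed.

Lemma coef_expansion v : exists m (w : 'I_m -> X),
  injective w /\ v = \sum_j coef (w j) v *: b (w j).
Proof.
have [m [w [c [w_inj vE]]]] := basis_expansion v; exists m, w; split=> //.
rewrite {1}vE; apply: eq_bigr => j _; congr (_ *: _).
rewrite vE linear_sum (bigD1 j)//= linearZ /= coef_basis eqxx big1 ?addr0.
  by rewrite [_ *: _]mulr1.
by move=> i ij; rewrite linearZ /= coef_basis (inj_eq w_inj) eq_sym (negPf ij) scaler0.
Qed.

Lemma coef_eq v u : (forall x, coef x v = coef x u) -> v = u.
Proof.
move=> vu; apply/eqP; rewrite -subr_eq0; apply/eqP.
have [m [w [_ ->]]] := coef_expansion (v - u).
by rewrite big1// => j _; rewrite linearB /= vu subrr scale0r.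
Qed.

End Basis.

Section BlockRepresentation.
Variables (K : fieldType) (V : lmodType K) (O X : choiceType) (Z : eqType).
Variables (bO : O -> V) (bX : X -> V).
Hypotheses (bO_basis : is_basis bO) (bX_basis : is_basis bX).
Variables (root : pred Z) (base : X -> Z) (coord : X -> O) (glue : Z -> O -> X).
Hypothesis base_root : forall x, root (base x).
Hypothesis glueK : forall x, glue (base x) (coord x) = x.
Hypothesis base_glue : forall z q, root z -> base (glue z q) = z.
Hypothesis coord_glue : forall z q, root z -> coord (glue z q) = q.
Variable alpha : Z -> Endo V -> Endo V.
Hypothesis alpha_hom : forall z,
  @is_alg_hom K (End_alg V) (End_alg V) (alpha z).

Definition block (z : Z) : {linear V -> V} :=
  basis_ext bO_basis (fun q => bX (glue z q)).

(** The direct sum over the blocks [z] of copies of [V], with [a] acting on each through [alpha z].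
    It is used with the twists as [alpha], then with their sum [theta]. *)
Definition block_rep (a : Endo V) : Endo V :=
  basis_ext bX_basis
    (fun x => block (base x) (alpha (base x) a (bO (coord x)))).

Lemma block_basis z q : block z (bO q) = bX (glue z q).
Proof. exact: basis_extE. Qed.

Lemma block_rep_basis a x :
  block_rep a (bX x) = block (base x) (alpha (base x) a (bO (coord x))).
Proof. exact: (basis_extE bX_basis). Qed.

Lemma block_repE a z v : root z -> block_rep a (block z v) = block z (alpha z a v).
Proof.
move=> zr.
pose f : {linear V -> V} := (block_rep a : {linear V -> V}) \o block z.
pose g : {linear V -> V} := block z \o (alpha z a : {linear V -> V}).
apply: (@basis_eq _ _ _ _ bO_basis _ f g) => q; rewrite /f /g /= block_basis.
by rewrite -[LHS]/(block_rep a (bX (glue z q))) block_rep_basis base_glue// coord_glue.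
Qed.

Lemma endo_basis_eq (f g : Endo V) : (forall x, f (bX x) = g (bX x)) -> f = g.
Proof. by move=> fg; apply: endo_inj; exact: (@basis_eq _ _ _ _ bX_basis). Qed.

Lemma block_rep_hom : @is_alg_hom K (End_alg V) (End_alg V) block_rep.
Proof.
split=> [c f g||f g]; apply: endo_basis_eq => x.
- rewrite block_rep_basis (alg_hom_linear (alpha_hom _)).
  rewrite -[RHS]/(c *: block_rep f (bX x) + block_rep g (bX x)) !block_rep_basis.
  by rewrite -linearP.
- rewrite block_rep_basis (alg_hom1 (alpha_hom _)).
  by rewrite -[RHS]/(bX x) -[in RHS](glueK x) -block_basis.
- rewrite block_rep_basis (alg_homM (alpha_hom _)).
  rewrite -[RHS]/(block_rep f (block_rep g (bX x))) block_rep_basis.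
  by rewrite block_repE.
Qed.

Lemma coef_block x z v : root z -> coef bX_basis x (block z v) =
  if base x == z then coef bO_basis (coord x) v else 0.
Proof.
move=> zr; case: eqP => xz.
  pose f : {linear V -> K^o} := coef bX_basis x \o block z.
  apply: (@basis_eq _ _ _ _ bO_basis _ f (coef bO_basis (coord x))) => q.
  rewrite /f /= block_basis !coef_basis; congr (_%:R); congr nat_of_bool.
  apply/eqP/eqP => [->|<-]; first by rewrite coord_glue.
  by rewrite -xz glueK.
pose f : {linear V -> K^o} := coef bX_basis x \o block z.
apply: (@basis_eq _ _ _ _ bO_basis _ f \0) => q.
rewrite /f /= block_basis coef_basis; case: eqP => // xE.
by case: xz; rewrite xE base_glue.
Qed.

End BlockRepresentation.

Section Twist.
Variables (K : fieldType) (V : lmodType K) (O : choiceType) (b : O -> V).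
Hypothesis b_basis : is_basis b.
Local Notation cf := (coef b_basis).

Definition transvection (e : K) (r s : O) : {linear V -> V} :=
  basis_ext b_basis (fun q => b q + (e *+ (q == r)) *: b s).

Lemma transvection_basis e r s q :
  transvection e r s (b q) = b q + (e *+ (q == r)) *: b s.
Proof. exact: basis_extE. Qed.

Lemma transvectionK e r s v :
  r != s -> transvection (- e) r s (transvection e r s v) = v.
Proof.
move=> rs.
pose f : {linear V -> V} := transvection (- e) r s \o transvection e r s.
apply: (@basis_eq _ _ _ _ b_basis _ f idfun) => q; rewrite /f /=.
rewrite !transvection_basis linearD linearZ /= !transvection_basis.
rewrite (eq_sym s) (negPf rs) scale0r addr0 -addrA -scalerDl -mulrnDl addNr mul0rn.
by rewrite scale0r addr0.
Qed.

(* An endomorphism that is diagonal in the basis b and in all its images under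
   transvections is scalar; [twist] thus lets off-diagonal entries suffice. *)
Definition twist (z : O * O) (a : Endo V) : Endo V :=
  if z.1 == z.2 then a else
  (transvection (-1) z.1 z.2 \o (a : {linear V -> V}) \o transvection 1 z.1 z.2 :
    {linear V -> V}).

Lemma twist_hom z : @is_alg_hom K (End_alg V) (End_alg V) (twist z).
Proof.
rewrite /twist; case: eqVneq => // rs.
split=> [c f g||f g]; apply: endo_inj => v.
- set u := transvection (-1) _ _; set t := transvection 1 _ _.
  by rewrite -[LHS]/(u (c *: f (t v) + g (t v))) linearP.
- exact: transvectionK.
- set u := transvection (-1) _ _; set t := transvection 1 _ _.
  rewrite -[LHS]/(u (f (g (t v)))) -[RHS]/(u (f (t (u (g (t v)))))).
  have tu w : t (u w) = w by have := transvectionK (-1) w rs; rewrite opprK.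
  by rewrite tu.
Qed.

End Twist.

Section OffDiagonal.
Variables (K : fieldType) (V : lmodType K) (O : choiceType) (b : O -> V).
Hypothesis b_basis : is_basis b.
Variables (e : O * O * O -> O) (d : O -> O * O * O).
Hypotheses (eK : cancel e d) (dK : cancel d e).

Local Notation cf := (coef b_basis).

(** The direct sum of all twists, one for each pair in [O * O], realised on [V] again through the
    bijection [e]. *)
Definition theta : Endo V -> Endo V :=
  block_rep b_basis b_basis (fun x => (d x).1) (fun x => (d x).2)
    (fun z q => e (z, q)) (twist b_basis).

Definition matrix_coef (p q : O) (a : Endo V) : K := cf q (theta a (b p)).

Lemma theta_hom : @is_alg_hom K (End_alg V) (End_alg V) theta.
Proof.
apply: (@block_rep_hom _ _ _ _ _ _ _ _ _ predT) => //.
- by move=> x; rewrite -surjective_pairing.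
- by move=> z q; rewrite eK.
- by move=> z q; rewrite eK.
- exact: twist_hom.
Qed.

Lemma matrix_coef_linear p q : linear (matrix_coef p q : Endo V -> K^o).
Proof.
move=> c f g; rewrite /matrix_coef (alg_hom_linear theta_hom).
by rewrite -[X in cf q X]/(c *: theta f (b p) + theta g (b p)) linearP.
Qed.

Lemma matrix_coef1 p q : p != q -> matrix_coef p q (endo_one V) = 0.
Proof.
move=> pq; rewrite /matrix_coef (alg_hom1 theta_hom).
by rewrite -[X in cf q X]/(b p) coef_basis eq_sym (negPf pq).
Qed.

Lemma twist_coef a z q q' :
  matrix_coef (e (z, q)) (e (z, q')) a = cf q' (twist b_basis z a (b q)).
Proof.
rewrite /matrix_coef /theta block_rep_basis !eK /=.
rewrite (@coef_block _ _ _ _ _ _ _ _ _ predT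
  (fun x => (d x).1) (fun x => (d x).2)) ?eK ?eqxx//.
- by move=> x; rewrite -surjective_pairing.
- by move=> ? ?; rewrite eK.
- by move=> ? ?; rewrite eK.
Qed.

(** The twist by [(o0, o0)] is trivial and shows that [a] is diagonal. For a diagonal [a], the entry
    from [r] to [s] of its twist by [(r, s)] is [l s - l r], so all diagonal entries agree. *)
Lemma endo_scalar (o0 : O) (a : Endo V) :
  (forall p q, p != q -> matrix_coef p q a = 0) ->
  exists c, a = c *: endo_one V.
Proof.
move=> a0.
have tw0 z q q' : q != q' -> cf q' (twist b_basis z a (b q)) = 0.
  move=> qq'; rewrite -twist_coef a0//.
  by apply: contra_neq qq' => /(can_inj eK)[].
pose l q := cf q (a (b q)).
have diag q : a (b q) = l q *: b q.
  apply: (coef_eq (b_basis := b_basis)) => q'; rewrite linearZ /= coef_basis.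
  have [->|q'q] := eqVneq q' q; first by rewrite [RHS]mulr1.
  have := tw0 (o0, o0) q q'; rewrite /twist eqxx eq_sym q'q => /(_ isT) ->.
  by rewrite scaler0.
have lE r s : l r = l s.
  have [->//|rs] := eqVneq r s; have := tw0 (r, s) r s rs.
  rewrite /twist (negPf rs); set u := transvection _ _ _ _; set t := transvection _ _ _ _.
  rewrite -[X in cf s X]/(u (a (t (b r)))) transvection_basis eqxx mulr1n scale1r.
  rewrite (_ : a (b r + b s) = a (b r) + a (b s)); last by rewrite /endo_fun linearD.
  rewrite !diag linearD !linearZ /= !transvection_basis eqxx mulr1n scaleN1r.
  rewrite (eq_sym s) (negPf rs) mulr0n scale0r addr0 linearD !linearZ /= linearB /=.
  rewrite !coef_basis eqxx (eq_sym s) (negPf rs) sub0r.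
  rewrite -[_ *: (- _)]/(_ * _) -[_ *: 1%:R]/(_ * _) mulrN !mulr1 addrC => /eqP.
  by rewrite subr_eq0 => /eqP ->.
exists (l o0); apply: (endo_basis_eq b_basis) => q.
by rewrite diag (lE q o0).
Qed.

End OffDiagonal.

Section NodeSize.
Variables (O : choiceType) (o0 : O).
Implicit Types (i : O -> bool) (x : node O).

Lemma size_node_base i x : (size (node_base o0 i x).2 <= size x.2)%N.
Proof. exact: size_base. Qed.

Lemma size_node_baseS i x : (size x.2 <= (size (node_base o0 i x).2).+1)%N.
Proof.
by rewrite /= /word_base; case: ifP => // _; rewrite size_behead; case: (size _).
Qed.

Lemma node_base_id i x : (size x.2 <= size (node_base o0 i x).2)%N ->
  node_base o0 i x = x.
Proof.
case: x => d [|l w]; rewrite /node_base /word_base /= => //.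
by case: ifP => // _; rewrite ltnn.
Qed.

Lemma node_coord_root i x : node_isroot o0 i x ->
  node_coord o0 i x = nth o0 x.1.2 (size x.2).
Proof. by rewrite /node_isroot /node_coord /word_coord => ->. Qed.

End NodeSize.

(** * Copies inside the endomorphism algebra and their independence *)

Section AlgebraCopies.
Variables (K : fieldType) (V : lmodType K) (O : choiceType) (o0 : O) (b : O -> V).
Hypothesis b_basis : is_basis b.
Variables (e : O * O * O -> O) (d : O -> O * O * O).
Hypotheses (eK : cancel e d) (dK : cancel d e).
Variable bX : node O -> V.
Hypothesis bX_basis : is_basis bX.
Local Notation index := (O -> bool).
Local Notation A := (Endo V).
Local Notation cf := (coef (bX_basis : @is_basis _ _ (node O : choiceType) bX)).
Local Notation psi := (matrix_coef b_basis e d).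

(** Acting by [theta] instead of by [a] itself makes off-diagonal entries detect every nonscalar
    letter. *)
Definition endo_copy (i : index) : A -> A :=
  block_rep b_basis (bX_basis : @is_basis _ _ (node O : choiceType) bX)
    (node_base o0 i) (node_coord o0 i)
    (node_glue o0 i) (fun=> theta b_basis e d).

Lemma endo_copy_hom i : @is_alg_hom K (End_alg V) (End_alg V) (endo_copy i).
Proof.
apply: (@block_rep_hom _ _ _ _ (node O : eqType) _ _ _ _ (node_isroot o0 i)).
- exact: node_base_root.
- exact: node_glueK.
- exact: node_base_glue.
- exact: node_coord_glue.
- by move=> _; exact: theta_hom.
Qed.

Lemma coef_endo_copy_basis i a x y : cf y (endo_copy i a (bX x)) =
  if node_base o0 i y == node_base o0 i x
  then psi (node_coord o0 i x) (node_coord o0 i y) a else 0.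
Proof.
rewrite /endo_copy block_rep_basis.
rewrite (@coef_block _ _ _ _ _ _ _ _ _ (node_isroot o0 i)
  (node_base o0 i) (node_coord o0 i))//.
- exact: node_glueK.
- exact: node_base_glue.
- exact: node_coord_glue.
- exact: node_base_root.
Qed.

Lemma coef_endo (f : A) y v : exists m (w : 'I_m -> node O),
  v = \sum_j cf (w j) v *: bX (w j) /\
  cf y (f v) = \sum_j cf (w j) v * cf y (f (bX (w j))).
Proof.
have [m [w [_ vE]]] := coef_expansion (bX_basis : @is_basis _ _ (node O : choiceType) bX) v.
exists m, w; split=> //; rewrite {1}vE /endo_fun !linear_sum.
by apply: eq_bigr => j _; rewrite !linearZ.
Qed.

Definition low n v := forall y : node O, (n < size y.2)%N -> cf y v = 0.

(** A copy acts within blocks, and the depths in a block differ by at most one. *)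
Lemma low_endo_copy n i a v : low n v -> low n.+1 (endo_copy i a v).
Proof.
move=> lv y ny; have [m [w [_ ->]]] := coef_endo (endo_copy i a) y v.
apply: big1 => j _; have [wn|/lv->] := leqP (size (w j).2) n; last first.
  by rewrite mul0r.
rewrite coef_endo_copy_basis; case: eqP => [E|_]; last by rewrite mulr0.
have := leq_trans ny (size_node_baseS o0 i y); rewrite E ltnS.
by move=> /leq_trans/(_ (size_node_base _ _ _)); rewrite ltnNge wn.
Qed.

(** A child receives contributions only from its block, where the base alone is shallow enough to
    occur in [v]. A node that is the base of its own block receives nothing, as that block contains
    no shallower node. *)
Lemma coef_endo_copy i a v D P t q w : low (size w) v ->
  cf (D, P, (t, q) :: w) (endo_copy i a v) =
  (if node_isroot o0 i (D, P, (t, q) :: w) then 0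
   else psi (nth o0 P (size w)) q a) * cf (D, P, w) v.
Proof.
move=> lv; set y := (D, P, (t, q) :: w); set x0 := (D, P, w).
have [m [u [vE ->]]] := coef_endo (endo_copy i a) y v.
rewrite [in RHS]vE linear_sum mulr_sumr; apply: eq_bigr => j _.
rewrite linearZ /= coef_basis -[_ *: _%:R]/(_ * _).
have [uw|/lv->] := leqP (size (u j).2) (size w); last by rewrite !mul0r mulr0.
rewrite mulrCA; congr (_ * _); rewrite coef_endo_copy_basis.
case: (boolP (node_isroot o0 i y)) => [yr|yNr].
  rewrite mul0r; case: eqP => // E.
  have yE : node_base o0 i y = y by rewrite /node_base /word_base -/(node_isroot o0 i y) yr.
  have : (size y.2 <= size w)%N by rewrite -yE E (leq_trans (size_node_base _ _ _)).
  by rewrite ltnn.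
have yE : node_base o0 i y = x0.
  by rewrite /node_base /word_base -/(node_isroot o0 i y) (negPf yNr).
have yc : node_coord o0 i y = q.
  by rewrite /node_coord /word_coord -/(node_isroot o0 i y) (negPf yNr).
have [x0u|x0u] := eqVneq x0 (u j).
  have x0r : node_isroot o0 i x0 by rewrite -yE node_base_root.
  have x0E : node_base o0 i x0 = x0.
    by rewrite /node_base /word_base -/(node_isroot o0 i x0) x0r.
  by rewrite yE -x0u x0E eqxx yc node_coord_root// mulr1.
rewrite yE mulr0; case: eqP => // E; case/eqP: x0u.
by rewrite E node_base_id // -E.
Qed.

Definition word_vector (L : seq (index * A)) (v : V) : V :=
  foldr (fun l v => endo_copy l.1 l.2 v) v L.

Lemma weval_endo_copy L v :
  (weval (endo_copy : index -> End_alg V -> End_alg V) L : A) v = word_vector L v.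
Proof. by elim: L => //= l L <-. Qed.

Lemma low_word_vector D P L : low (size L) (word_vector L (bX (D, P, [::]))).
Proof.
elim: L => [y /= y0|l L IH]; last exact: low_endo_copy.
by rewrite coef_basis; case: eqP y0 => // ->.
Qed.

(** The analogue of [target] with prescribed labels [tau] and prescribed positions [q]. *)
Fixpoint leaf (D : seq O) (q : nat -> O) (tau : seq index) : seq (seq bool * O) :=
  if tau is i :: tau' then (map i D, q (size tau')) :: leaf D q tau' else [::].

Lemma size_leaf D q tau : size (leaf D q tau) = size tau.
Proof. by elim: tau => //= i tau ->. Qed.

(** By [coef_endo_copy], a letter whose index matches [tau] contributes one off-diagonal entry. For
    another index the labels differ, the leaf is the base of its block, and the coefficient
    vanishes. *)
Lemma coef_word_vector D P (p q : nat -> O) (S : seq index) tau L :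
  {in S &, injective (fun i : index => map i D)} ->
  {subset tau <= S} -> {subset unzip1 L <= S} ->
  sorted (fun i j => i != j) tau -> (forall k, p k != q k) ->
  (forall k, k < size tau -> nth o0 P k = p k)%N ->
  size L = size tau ->
  cf (D, P, leaf D q tau) (word_vector L (bX (D, P, [::]))) =
  if unzip1 L == tau then coef_word (A := End_alg V) psi p q (unzip2 L) else 0.
Proof.
move=> Dinj + + + pq.
elim: tau L => [|i tau IH] [|[j a] L] //= tS LS st Pp => [_|[sz]].
  by rewrite coef_basis eqxx.
have iS : i \in S by rewrite tS// mem_head.
have jS : j \in S by rewrite LS// mem_head.
have tS' : {subset tau <= S} by move=> k kt; rewrite tS// inE kt orbT.
rewrite coef_endo_copy ?size_leaf; last by rewrite -sz; exact: low_word_vector.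
rewrite IH//; first last.
- by move=> k kt; apply: Pp; rewrite leqW.
- exact: path_sorted st.
- by move=> k kt; rewrite LS// inE kt orbT.
rewrite eqseq_cons; case: (unzip1 L =P tau) => _; last by rewrite andbF mulr0.
have qp : q (size tau) != p (size tau) by rewrite eq_sym.
rewrite andbT /node_isroot /= size_leaf Pp// qp /= size_map sz.
have [->|ji] := eqVneq j i.
  rewrite eqxx /=.
  suff -> : isroot (nth o0 P) [seq i x | x <- D] (leaf D q tau) by [].
  case: tau st tS' {IH tS Pp sz qp} => //= k tau /andP[ik _] kS.
  case: eqP => // /Dinj E; move: ik; rewrite E ?eqxx//.
  by apply: kS; rewrite mem_head.
case: eqP => [/Dinj E|_ /=]; last by rewrite mul0r.
by rewrite E// eqxx in ji.
Qed.

Section Freeness.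
Variables (R : assocAlgebra K) (h : index -> End_alg V -> R) (pi : R -> End_alg V).
Hypothesis h_hom : forall i, is_alg_hom (h i).
Hypothesis pi_hom : is_alg_hom pi.
Hypothesis pi_h : forall i a, pi (h i a) = endo_copy i a.
Hypothesis O_nontrivial : exists p q : O, p != q.

Lemma pi_weval L v : (pi (weval h L) : A) v = word_vector L v.
Proof.
rewrite -weval_endo_copy (weval_hom _ _ pi_hom).
by rewrite (eq_weval (A := End_alg V) (B := End_alg V) (g := endo_copy)).
Qed.

Lemma pi_sum (T : Type) (s : seq T) (P : pred T) (F : T -> R) v :
  (pi (\sum_(t <- s | P t) F t) : A) v = \sum_(t <- s | P t) (pi (F t) : A) v.
Proof.
elim/big_rec2: _ => [|t x y _ <-]; first by rewrite alg_hom0.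
by rewrite alg_homD.
Qed.

Lemma piZ c x v : (pi (c *: x) : A) v = c *: (pi x : A) v.
Proof. by rewrite alg_homZ. Qed.

Lemma merge_word L : ~~ sorted (fun i j => i != j) (unzip1 L) ->
  exists L', (size L' < size L)%N /\ weval h L = weval h L'.
Proof.
elim: L => // -[i a] [|[j c] L] // IH; rewrite /= negb_and negbK.
move=> /orP[/eqP ij|/IH[L' [sL' LE]]].
  exists ((j, alg_mul (a : End_alg V) c) :: L); split=> //=.
  by rewrite ij (alg_homM (h_hom j)) alg_mulA.
by exists ((i, a) :: L'); split=> //=; rewrite -LE.
Qed.

(* The coefficient at the leaf with labels tau isolates the words of type tau
   among the alternating words of maximal length. *)
Lemma shorter_kernel n x : shorter h n x -> pi x = 0 -> x = 0.
Proof.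
elim: n x => [x /shorter_lt0//|n IH x].
move=> [s [sn ->]] pix0; apply: IH => //.
(* Only alternating words of length [n] matter: in the others of that length two adjacent letters
   merge. *)
pose top (y : K * seq (index * A)) :=
  (size y.2 == n) && sorted (fun i j => i != j) (unzip1 y.2).
have low_part : shorter h n (\sum_(y <- s | ~~ top y) y.1 *: weval h y.2).
  rewrite -big_filter; apply: shorter_sum => y; rewrite mem_filter => /andP[+ ys].
  rewrite negb_and; have := sn _ ys; rewrite ltnS leq_eqVlt => /orP[/eqP yn|yn _]; last first.
    exact: shorter_word.
  by rewrite yn eqxx /= => /merge_word[L' [+ ->]]; rewrite yn; exact: shorter_word.
rewrite /ceval (bigID top) /=; apply: shorterD => //.
pose T := undup [seq unzip1 y.2 | y <- s & top y].
have -> : \sum_(y <- s | top y) y.1 *: weval h y.2 =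
    \sum_(tau <- T) \sum_(y <- s | top y && (unzip1 y.2 == tau)) y.1 *: weval h y.2.
  rewrite (exchange_big_dep top)/= => [|tau y _ /andP[]//].
  rewrite [LHS]big_seq_cond [RHS]big_seq_cond; apply: eq_bigr => y /andP[ys ty].
  rewrite ty /= (big_rem (unzip1 y.2)) /=; last first.
    by rewrite mem_undup; apply/mapP; exists y => //; rewrite mem_filter ty.
  rewrite eqxx big1_seq ?addr0// => tau /andP[/eqP <-].
  by rewrite mem_rem_uniq ?undup_uniq// inE eqxx.
apply: shorter_sum => tau; rewrite mem_undup => /mapP[y0].
rewrite mem_filter => /andP[/andP[/eqP y0n st] y0s tauE].
have sz_tau : size tau = n by rewrite tauE size_map.
pose st' := [seq (y.1, unzip2 y.2) | y <- s & top y && (unzip1 y.2 == tau)].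
have -> : \sum_(y <- s | top y && (unzip1 y.2 == tau)) y.1 *: weval h y.2 =
    \sum_(y <- st') y.1 *: weval h (zip tau y.2).
  rewrite big_map big_filter; apply: eq_bigr => y /andP[_ /eqP <-].
  by rewrite zip_unzip.
rewrite -sz_tau; apply: (elimination h_hom (psi := psi)) => //.
- exact: matrix_coef_linear.
- exact: matrix_coef1.
- exact: endo_scalar.
- move=> z /mapP[y]; rewrite mem_filter => /andP[/andP[_ /eqP <-] _] ->.
  by rewrite !size_map.
move=> p q pq; rewrite big_map big_filter.
pose S := flatten [seq unzip1 y.2 | y <- s].
have [D Dinj] := separating_seq S.
pose P := mkseq p n.
have memS y : y \in s -> {subset unzip1 y.2 <= S}.
  by move=> ys i iy; apply/flattenP; exists (unzip1 y.2) => //; exact: map_f.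
(* The vanishing of [pi x] is read at one leaf, starting from the root of a tree whose [D] separates
   all indices and whose [P] lists [p]. *)
pose v0 := bX (D, P, [::]); pose lf : node O := (D, P, leaf D q tau).
have : cf lf ((pi (ceval h s) : A) v0) = 0 by rewrite pix0 linear0.
rewrite /ceval pi_sum linear_sum /= => E; rewrite -[RHS]E.
rewrite [RHS](bigID (fun y => top y && (unzip1 y.2 == tau))) /=.
rewrite [X in _ = _ + X]big1_seq ?addr0.
  rewrite [LHS]big_seq_cond [RHS]big_seq_cond; apply: eq_bigr => y.
  move=> /andP[ys /andP[/andP[/eqP yn sy] /eqP yt]].
  rewrite piZ pi_weval linearZ /= -[RHS]/(_ * _); congr (_ * _).
  rewrite (@coef_word_vector D P p q S) ?yt ?eqxx//.
  - by rewrite tauE; exact: memS.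
  - by rewrite -yt; exact: memS.
  - by rewrite -yt.
  - by move=> k; rewrite sz_tau => kn; rewrite nth_mkseq.
  - by rewrite yn sz_tau.
(* The remaining words contribute nothing: shorter ones do not reach the depth of the leaf, and
   those of length [n] have a type other than [tau]. *)
move=> y /andP[ny ys]; rewrite piZ pi_weval linearZ /= -[LHS]/(_ * _).
have := sn _ ys; rewrite ltnS leq_eqVlt => /orP[/eqP yn|yn]; last first.
  by rewrite (@low_word_vector D P y.2) ?mulr0//= size_leaf sz_tau.
rewrite (@coef_word_vector D P p q S) ?yn//.
- case: eqP => [yt|_]; last by rewrite mulr0.
  by move: ny; rewrite /top yn eqxx yt eqxx tauE st.
- by rewrite tauE; exact: memS.
- exact: memS.
- by rewrite tauE.
- by move=> k; rewrite sz_tau => kn; rewrite nth_mkseq.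
Qed.

End Freeness.
End AlgebraCopies.

Lemma is_basis_comp (K : fieldType) (V : lmodType K) (X Y : Type) (b : Y -> V)
    (f : X -> Y) : bijective f -> is_basis b -> is_basis (b \o f).
Proof.
move=> [g fK gK] [free_b gen_b]; split=> [n w c w_inj|v].
  by apply: (free_b n (f \o w) c) => i j /(can_inj fK)/w_inj.
have [n [w [c ->]]] := gen_b v; exists n, (g \o w), c.
by apply: eq_bigr => i _ /=; rewrite gK.
Qed.

Lemma triple_bijection (T : Type) : infinite_set [set: T] ->
  exists h : T * T * T -> T, bijective h.
Proof.
move=> Tinf; have [g g_inj] := pairing_injection Tinf.
apply: (bijective_of_injective (f := fun x => g (g x.1.1 x.1.2) x.2)
  (g := fun x => (x, x, x))); last by move=> x y [].
by move=> [[x y] z] [[x' y'] z'] /= /g_inj[/g_inj[-> ->] ->].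
Qed.

Lemma End_coproduct (O : choiceType) (K : fieldType) (V : lmodType K)
    (b : O -> V) : infinite_set [set: O] -> is_basis b ->
  algebra_contains_coproduct (O -> bool) (End_alg V).
Proof.
move=> Oinf b_basis.
have [e [d eK dK]] := triple_bijection Oinf.
have [f f_bij] := node_bijection Oinf.
have [o0 _] := infinite_setN0 Oinf.
have nontrivial : exists p q : O, p != q.
  have [//|eqO] := pselect (exists p q : O, p != q).
  exfalso; apply: Oinf; apply: (sub_finite_set _ (finite_set1 o0)) => x _.
  by apply: contrapT => xo; apply: eqO; exists x, o0; apply/eqP.
(* The same space gets a basis indexed by the nodes, on which the copies act. *)
have bX_basis : is_basis (b \o f) := is_basis_comp f_bij b_basis.
apply: (@algebra_coproduct _ _ (End_alg V) (End_alg V)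
  (endo_copy o0 b_basis e d bX_basis)).
  by move=> i; exact: endo_copy_hom.
move=> R h pi s h_hom pi_hom pi_h.
(* The induction may start from any strict bound on the word lengths in [s]. *)
apply: (shorter_kernel eK dK h_hom pi_hom pi_h nontrivial
  (n := \max_(y <- s) (size y.2).+1)).
exists s; split=> // y ys.
exact: (@leq_bigmax_seq _ s predT (fun y => (size y.2).+1) y ys).
Qed.

Theorem theorem4p2 (Omega : Type) (Omega_inf : infinite_set [set: Omega])
    (K : fieldType) (V : lmodType K) (b : Omega -> V) (b_basis : is_basis b) :
  [/\ group_contains_coproduct (Omega -> bool) (Sym Omega),
      monoid_contains_coproduct (Omega -> bool) (Self Omega)
    & algebra_contains_coproduct (Omega -> bool) (End_alg V)].
Proof.
have [sym self] := sym_self_coproducts Omega_inf.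
split=> //; exact: (@End_coproduct {classic Omega} K V b).
Qed.
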